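(* There exists a finite tile set $T$ such that for every integer $k \geq 7$ there exists a nondecreasing temperature function $\tau_k:\mathbb{N}\to\mathbb{N}$ for which the size-dependent system $(T,\tau_k)$ self-assembles a $k \times 3$ rectangle.
   Context: Size-dependent two-handed tile assembly model. A tile type is a quadruple $(g_N,g_E,g_S,g_W)$ of glues from an alphabet $\Sigma$, each glue $g$ having a non-negative integer strength $\mathrm{str}(g)$. A tile is a unit square centered at a point of $\mathbb{Z}^2$ labeled by a tile type; two tiles are adjacent if their centers are at distance 1. An assembly is a partial map $\alpha:\mathbb{Z}^2\to T$ with finite domain $\mathrm{dom}(\alpha)$. Two adjacent tiles form a bond if the glues on their abutting edges are equal and of positive strength; the strength of the bond is that glue's strength. The bond graph of $\alpha$ has vertex set $\mathrm{dom}(\alpha)$ and an edge for each bond. A cut of an assembly is an edge cut of its bond graph (a partition of $\mathrm{dom}(\alpha)$ into two nonempty parts), and its strength is the total strength of bonds crossing it. A supertile $\tilde\alpha$ is the equivalence class of an assembly under translation; its size $|\tilde\alpha|$ is the number of tiles of an assembly in it. A size-dependent system is a pair $(T,\tau)$ with $T$ a finite tile set and $\tau:\mathbb{N}\to\mathbb{N}$ a nondecreasing temperature function. An assembly $\gamma$ is $\tau$-stable if every cut partitioning $\mathrm{dom}(\gamma)$ into parts $\alpha,\beta$ has strength at least $\tau(\min(|\alpha|,|\beta|))$. Two supertiles $\tilde\alpha,\tilde\beta$ can combine into $\tilde\gamma$ if there are disjoint assemblies $\alpha\in\tilde\alpha$, $\beta\in\tilde\beta$ with $\alpha\cup\beta=\gamma\in\tilde\gamma$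 and the cut separating $\mathrm{dom}(\alpha)$ from $\mathrm{dom}(\beta)$ has strength at least $\tau(\min(|\alpha|,|\beta|))$. A supertile $\tilde\gamma$ can break into $\tilde\alpha,\tilde\beta$ if there are disjoint assemblies $\alpha\in\tilde\alpha,\beta\in\tilde\beta$ with connected bond graphs, $\alpha\cup\beta=\gamma\in\tilde\gamma$, and the cut separating them has strength less than $\tau(\min(|\alpha|,|\beta|))$. A supertile is producible if it is a single tile of a type in $T$, a combination of two producible supertiles, or a result of a break of a producible supertile. A producible supertile is terminal if it can combine with no producible supertile and cannot break. The system self-assembles a shape $P\subseteq\mathbb{Z}^2$ if every terminal supertile has an assembly whose domain is exactly $P$ (and, implicitly, a terminal supertile exists). A $w\times h$ rectangle is a set $\{x+1,\dots,x+w\}\times\{y+1,\dots,y+h\}$ for some integers $x,y$. *)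

(* Defs.v *)
From Stdlib Require Import Bool ZArith List Relations.
Import ListNotations.
Open Scope Z_scope.

(** Glue alphabet: natural numbers (a finite tile set only uses finitely many);
    a glue strength function [str : glue -> nat] is part of the data. *)
Definition glue := nat.

Record tiletype := TileType { gN : glue; gE : glue; gS : glue; gW : glue }.

Definition pos := (Z * Z)%type.

(** An assembly: a finite partial map Z^2 -> tile types, represented as a list
    of (position, tile type) pairs with pairwise distinct positions ([wf]). *)
Definition assembly := list (pos * tiletype).

Definition wf (a : assembly) : Prop := NoDup (map fst a).

Definition dom (a : assembly) : list pos := map fst a.

Definition pos_eqb (p q : pos) : bool := Z.eqb (fst p) (fst q) && Z.eqb (snd p) (snd q).

Fixpoint lookup (a : assembly) (p : pos) : option tiletype :=
  match a with
  | [] => None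
  | (q, t) :: r => if pos_eqb q p then Some t else lookup r p
  end.

Definition size (a : assembly) : nat := length a.

Definition disjoint (a b : assembly) : Prop :=
  forall p, In p (dom a) -> ~ In p (dom b).

Definition translate (d : pos) (a : assembly) : assembly :=
  map (fun x => ((fst (fst x) + fst d, snd (fst x) + snd d), snd x)) a.

Definition bondstr (str : glue -> nat) (x y : pos * tiletype) : nat :=
  let '((px, py), t) := x in
  let '((qx, qy), u) := y in
  if Z.eqb qx (px + 1) && Z.eqb qy py then
    (if Nat.eqb (gE t) (gW u) then str (gE t) else 0%nat)
  else if Z.eqb qx (px - 1) && Z.eqb qy py then
    (if Nat.eqb (gW t) (gE u) then str (gW t) else 0%nat)
  else if Z.eqb qx px && Z.eqb qy (py + 1) then
    (if Nat.eqb (gN t) (gS u) then str (gN t) else 0%nat)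
  else if Z.eqb qx px && Z.eqb qy (py - 1) then
    (if Nat.eqb (gS t) (gN u) then str (gS t) else 0%nat)
  else 0%nat.

Definition bond (str : glue -> nat) (x y : pos * tiletype) : Prop :=
  (0 < bondstr str x y)%nat.

Definition cutstr (str : glue -> nat) (a b : assembly) : nat :=
  fold_right Nat.add 0%nat
    (map (fun x => fold_right Nat.add 0%nat (map (bondstr str x) b)) a).

Definition connected (str : glue -> nat) (a : assembly) : Prop :=
  forall x y, In x a -> In y a ->
    clos_refl_trans _ (fun u v => In u a /\ In v a /\ bond str u v) x y.

Definition splits (g a b : assembly) : Prop :=
  wf (a ++ b) /\ forall p, lookup g p = lookup (a ++ b) p.

Definition can_combine (str : glue -> nat) (tau : nat -> nat) (a b : assembly) : Prop :=
  disjoint a b /\ (tau (Nat.min (size a) (size b)) <= cutstr str a b)%nat.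

Definition breaks_into (str : glue -> nat) (tau : nat -> nat) (g a b : assembly) : Prop :=
  splits g a b /\ a <> [] /\ b <> [] /\ connected str a /\ connected str b /\
  (cutstr str a b < tau (Nat.min (size a) (size b)))%nat.

(** Producible assemblies (the assemblies belonging to producible supertiles);
    closed under translation. *)
Inductive producible (str : glue -> nat) (T : list tiletype) (tau : nat -> nat)
  : assembly -> Prop :=
| prod_single : forall t p, In t T -> producible str T tau [(p, t)]
| prod_translate : forall d a, producible str T tau a ->
    producible str T tau (translate d a)
| prod_combine : forall a b, producible str T tau a -> producible str T tau b ->
    can_combine str tau a b -> producible str T tau (a ++ b)
| prod_break_l : forall g a b, producible str T tau g ->
    breaks_into str tau g a b -> producible str T tau a
| prod_break_r : forall g a b, producible str T tau g ->
    breaks_into str tau g a b -> producible str T tau b.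

Definition terminal (str : glue -> nat) (T : list tiletype) (tau : nat -> nat)
  (a : assembly) : Prop :=
  producible str T tau a /\
  (forall b, producible str T tau b -> ~ can_combine str tau a b) /\
  (forall b c, ~ breaks_into str tau a b c).

Definition self_assembles (str : glue -> nat) (T : list tiletype) (tau : nat -> nat)
  (P : pos -> Prop) : Prop :=
  (exists a, terminal str T tau a) /\
  (forall a, terminal str T tau a ->
     exists d, forall p, In p (dom (translate d a)) <-> P p).

Definition rect (w h : nat) (p : pos) : Prop :=
  1 <= fst p <= Z.of_nat w /\ 1 <= snd p <= Z.of_nat h.

Definition nondecreasing (tau : nat -> nat) : Prop :=
  forall m n, (m <= n)%nat -> (tau m <= tau n)%nat.

(* Main.v *)
Require Import Defs.
From Stdlib Require Import ZArith List Arith Lia Permutation Sorted Relations.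
Import ListNotations.

(** The tiles form "snakes": Hamiltonian paths of n x 3 rectangles running down
    and up alternate columns from the top left corner to the top right corner,
    with bonds of strength 3.  A second species is a single tile that forms
    unbounded rows, also with bonds of strength 3.  The two end tiles of a
    complete snake carry on their north side a contact glue of strength 1 that
    matches the south side of every row tile.

    The temperature is 2 for sizes below k, then 3 for sizes m with 2m <= 3k,
    then 4.  A row covering both ends of a complete snake of width n bonds to it
    with strength 2, which is enough exactly when the smaller part has fewer than
    k tiles: a snake of width n < k therefore attaches to the row of length n, but
    no row attaches to a snake of width k.  A snake of width n > k can be cut
    along one bond into two parts of more than 3k/2 tiles, so it breaks, while
    the snake of width k cannot.  Incomplete snakes and all rows can always grow.

    The invariant is that every producible assembly is either a contiguous piece
    of a snake, or a row with complete snakes hanging from it by both ends. *)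

(** [M0], ..., [M5] are the two columns of the periodic part of a snake, [M0]-[M2]
    going down and [M3]-[M5] going up.  A snake begins with [Start] in place of [M0].
    It ends with [EvenEnd] in place of [M5], or, when the width is odd, with the
    zigzag [O0], ..., [O5] through two columns, which brings the path back to the
    top row. *)
Inductive state :=
  M0 | M1 | M2 | M3 | M4 | M5 | Start | EvenEnd | O0 | O1 | O2 | O3 | O4 | O5 | Row.

(** Glue 13 is the contact glue, glue 12 joins row tiles, glue 0 is inert, and
    each other glue labels one kind of step of the path. *)
Definition tile (q : state) : tiletype :=
  (match q with
  | M0 => TileType 0 0 1 6
  | M1 => TileType 1 0 2 0
  | M2 => TileType 2 3 0 0
  | M3 => TileType 4 0 0 3
  | M4 => TileType 5 0 4 0
  | M5 => TileType 0 6 5 0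
  | Start => TileType 13 0 1 0
  | EvenEnd => TileType 13 0 5 0
  | O0 => TileType 0 7 0 3
  | O1 => TileType 8 0 0 7
  | O2 => TileType 0 0 8 9
  | O3 => TileType 10 9 0 0
  | O4 => TileType 0 11 10 0
  | O5 => TileType 13 0 0 11
  | Row => TileType 0 12 13 12
  end)%nat.

Definition strength (g : glue) : nat :=
  (match g with 0 => 0 | 13 => 1 | _ => 3 end)%nat.

Definition tiles : list tiletype :=
  map tile [M0; M1; M2; M3; M4; M5; Start; EvenEnd; O0; O1; O2; O3; O4; O5; Row].

(** The path steps along strength 3 glues. It branches at [M2], towards another upward column or the
    odd end block, and at [M4], towards continuation or [EvenEnd]. Backwards, [M1] alone has two
    predecessors. *)
Definition succ (q r : state) : bool :=
  match q, r with
  | M0, M1 | Start, M1 | M1, M2 | M2, M3 | M2, O0 | M3, M4 | M4, M5 | M4, EvenEnd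
  | M5, M0 | O0, O1 | O1, O2 | O2, O3 | O3, O4 | O4, O5 => true
  | _, _ => false
  end.

Definition step (q : state) : pos :=
  match q with
  | M0 | Start | M1 => (0, -1)
  | M2 | M5 | O0 | O4 => (1, 0)
  | M3 | M4 | O1 | O3 => (0, 1)
  | O2 => (-1, 0)
  | _ => (0, 0)
  end.

Definition contact (q : state) : bool :=
  match q with Start | EvenEnd | O5 => true | _ => false end.

(** * Cells and the bonds between them *)

Definition cell := (pos * state)%type.
(** Cells carry states instead of tile types, so that facts about tiles reduce to finite case
    analysis; [tile] is injective, so nothing is lost. *)
Definition emb (x : cell) : pos * tiletype := (fst x, tile (snd x)).

Definition link (x y : cell) : Prop :=
  succ (snd x) (snd y) = true /\
  fst (fst y) = fst (fst x) + fst (step (snd x)) /\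
  snd (fst y) = snd (fst x) + snd (step (snd x)).

Definition rowlink (x y : cell) : Prop :=
  snd x = Row /\ snd y = Row /\ snd (fst x) = snd (fst y) /\
  (fst (fst y) = fst (fst x) + 1 \/ fst (fst y) = fst (fst x) - 1).

Definition above (x : cell) : cell := ((fst (fst x), snd (fst x) + 1), Row).

Definition hang (x y : cell) : Prop := contact (snd x) = true /\ y = above x.

Definition bs (x y : cell) : nat := bondstr strength (emb x) (emb y).

Lemma bondstr_sym s x y : bondstr s x y = bondstr s y x.
Proof.
  destruct x as [[a b] t], y as [[c d] u]; unfold bondstr.
  repeat match goal with
  | |- context [Z.eqb ?m ?n] => destruct (Z.eqb_spec m n); simpl; try lia
  end; rewrite Nat.eqb_sym;
  match goal with |- context [Nat.eqb ?m ?n] => destruct (Nat.eqb_spec m n); congruence end.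
Qed.

Lemma bs_sym x y : bs x y = bs y x.
Proof. apply bondstr_sym. Qed.

(** The glues are distributed so that, over all directions and pairs of states, the only matches are
    path steps, row neighbours and contacts. No single bond has strength 2. *)
Lemma bs_spec x y :
  bs x y = 0%nat \/
  (bs x y = 3%nat /\ (link x y \/ link y x \/ rowlink x y)) \/
  (bs x y = 1%nat /\ (hang x y \/ hang y x)).
Proof.
  destruct x as [[a b] q], y as [[c d] r].
  unfold bs, bondstr, emb, link, rowlink, hang, above; cbn [fst snd].
  repeat match goal with
  | |- context [Z.eqb ?m ?n] => destruct (Z.eqb_spec m n); cbn [andb]
  end; try (left; reflexivity); subst;
  destruct q, r; cbn; auto; right;
  solve [ left; split; [reflexivity|];
          first [ left; repeat split; cbn; lia
                | right; left; repeat split; cbn; lia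
                | right; right; repeat split; cbn; lia ]
        | right; split; [reflexivity|];
          first [ left; split; [reflexivity|]; repeat f_equal; lia
                | right; split; [reflexivity|]; repeat f_equal; lia ] ].
Qed.

Ltac unz := repeat match goal with
  | |- context [Z.eqb ?m ?n] => destruct (Z.eqb_spec m n); cbn [andb]; try lia
  end.

Lemma bs_link x y : link x y -> bs x y = 3%nat.
Proof.
  destruct x as [[a b] q], y as [[c d] r].
  unfold bs, bondstr, emb, link; cbn [fst snd]; intros (H & H1 & H2).
  destruct q, r; try discriminate H; cbn in *; unz; reflexivity.
Qed.

Lemma bs_rowlink x y : rowlink x y -> bs x y = 3%nat.
Proof.
  destruct x as [[a b] q], y as [[c d] r].
  unfold bs, bondstr, emb, rowlink; cbn [fst snd]; intros (-> & -> & H1 & H2).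
  cbn in *; unz; reflexivity.
Qed.

Lemma bs_hang x y : hang x y -> bs x y = 1%nat.
Proof.
  destruct x as [[a b] q], y as [[c d] r].
  unfold bs, bondstr, emb, hang, above; cbn [fst snd]; intros (H & [= -> -> ->]).
  destruct q; try discriminate H; cbn in *; unz; reflexivity.
Qed.

(** * Strength of a cut *)

Lemma list_sum_incl {A} (f : A -> nat) (l m : list A) :
  NoDup l -> incl l m -> (list_sum (map f l) <= list_sum (map f m))%nat.
Proof.
  revert m; induction l as [|x l IH]; intros m Hl Hm; [apply Nat.le_0_l|].
  inversion Hl as [|? ? Hx Hl']; subst.
  destruct (in_split x m (Hm x (or_introl eq_refl))) as (m1 & m2 & ->).
  assert (H : (list_sum (map f l) <= list_sum (map f (m1 ++ m2)))%nat).
  { apply IH; trivial. intros y Hy.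
    assert (Hy' := Hm y (or_intror Hy)). rewrite in_app_iff in *.
    destruct Hy' as [?|[->|?]]; tauto. }
  rewrite map_app, list_sum_app in *. unfold list_sum in *. cbn in *. lia.
Qed.

(** Terms where [f] vanishes can be filtered out; what remains is duplicate-free and included in
    [l]. *)
Lemma list_sum_support {A} (f : A -> nat) (l m : list A) :
  NoDup m -> (forall x, In x m -> f x <> 0%nat -> In x l) ->
  (list_sum (map f m) <= list_sum (map f l))%nat.
Proof.
  intros Hm H.
  assert (E : list_sum (map f m) =
              list_sum (map f (filter (fun x => negb (f x =? 0)%nat) m))).
  { clear. induction m as [|x m IH]; [reflexivity|]. unfold list_sum in *. cbn.
    destruct (Nat.eqb_spec (f x) 0) as [E|E]; cbn; lia. }
  rewrite E. apply list_sum_incl; [now apply NoDup_filter|].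
  intros x Hx. apply filter_In in Hx as [Hx Hf].
  apply H; trivial. intros E0; rewrite E0 in Hf; discriminate.
Qed.

Lemma NoDup_list_prod {A B} (l : list A) (m : list B) :
  NoDup l -> NoDup m -> NoDup (list_prod l m).
Proof.
  intros Hl Hm; induction Hl as [|x l Hx Hl IH]; cbn; [constructor|].
  apply NoDup_app; trivial.
  - apply FinFun.Injective_map_NoDup; trivial. now intros ? ? [= ->].
  - intros [u v] H1 H2. apply in_map_iff in H1 as (? & [= <- <-] & ?).
    apply in_prod_iff in H2. tauto.
Qed.

Definition bsp (p : cell * cell) : nat := bs (fst p) (snd p).
(** One sum over pairs in place of the nested sum of [cutstr]: exhibiting distinct crossing pairs
    bounds it from below, listing all bonded pairs bounds it from above. *)
Definition cut (a b : list cell) : nat := list_sum (map bsp (list_prod a b)).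

Lemma cutstr_emb a b : cutstr strength (map emb a) (map emb b) = cut a b.
Proof.
  unfold cutstr, cut. induction a as [|x a IH]; [reflexivity|].
  cbn. rewrite map_app, list_sum_app, <- IH. f_equal.
  unfold list_sum; rewrite !map_map. reflexivity.
Qed.

Lemma cut_one a b x y : In x a -> In y b -> (bs x y <= cut a b)%nat.
Proof.
  intros Hx Hy.
  assert (H := list_sum_incl bsp [(x, y)] (list_prod a b)). cbn in H.
  rewrite Nat.add_0_r in H. apply H.
  - repeat constructor; auto.
  - intros p [<-|[]]. now apply in_prod.
Qed.

Lemma cut_two a b x y x' y' :
  In x a -> In y b -> In x' a -> In y' b -> (x, y) <> (x', y') ->
  (bs x y + bs x' y' <= cut a b)%nat.
Proof.
  intros Hx Hy Hx' Hy' Hn.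
  assert (H := list_sum_incl bsp [(x, y); (x', y')] (list_prod a b)). cbn in H.
  rewrite Nat.add_0_r in H. apply H.
  - repeat constructor; cbn; intuition congruence.
  - intros p [<-|[<-|[]]]; now apply in_prod.
Qed.

Lemma cut_le a b l : NoDup a -> NoDup b ->
  (forall x y, In x a -> In y b -> bs x y <> 0%nat -> In (x, y) l) ->
  (cut a b <= list_sum (map bsp l))%nat.
Proof.
  intros Ha Hb H. apply list_sum_support.
  - now apply NoDup_list_prod.
  - intros [x y] Hp. apply in_prod_iff in Hp as []. now apply H.
Qed.

Lemma cut_cons_l x a b :
  cut (x :: a) b = (list_sum (map (bs x) b) + cut a b)%nat.
Proof.
  unfold cut. cbn [list_prod]. now rewrite map_app, list_sum_app, map_map.
Qed.

Lemma cut_cons_r y a b :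
  cut a (y :: b) = (list_sum (map (fun x => bs x y) a) + cut a b)%nat.
Proof.
  induction a as [|x a IH]; [reflexivity|].
  rewrite !cut_cons_l, IH. unfold list_sum; cbn. lia.
Qed.

Lemma cut_sym a b : cut a b = cut b a.
Proof.
  induction a as [|x a IH].
  - induction b; [reflexivity|]. now rewrite cut_cons_l.
  - rewrite cut_cons_l, cut_cons_r, IH. f_equal. f_equal.
    apply map_ext. intros y. apply bs_sym.
Qed.

Lemma cell_eq_dec (x y : cell) : {x = y} + {x <> y}.
Proof. repeat decide equality. Qed.

(** Bonds have strength 0, 1 or 3, so without a strong bond a total of 2 needs two different weak
    ones. *)
Lemma cut_ge2 a b : NoDup a -> NoDup b -> (2 <= cut a b)%nat ->
  (exists x y, In x a /\ In y b /\ bs x y = 3%nat) \/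
  (exists x y x' y', In x a /\ In y b /\ In x' a /\ In y' b /\
     bs x y = 1%nat /\ bs x' y' = 1%nat /\ (x, y) <> (x', y')).
Proof.
  intros Ha Hb Hc.
  set (P := list_prod a b).
  destruct (existsb (fun p => bsp p =? 3)%nat P) eqn:E3.
  { apply existsb_exists in E3 as ([x y] & Hp & E). left; exists x, y.
    apply in_prod_iff in Hp as []. apply Nat.eqb_eq in E. auto. }
  right.
  assert (N3 : forall x y, In x a -> In y b -> bs x y <> 3%nat).
  { intros x y Hx Hy E. apply Bool.not_true_iff_false in E3; apply E3.
    apply existsb_exists. exists (x, y). split; [now apply in_prod|].
    now apply Nat.eqb_eq. }
  assert (V : forall x y, In x a -> In y b -> bs x y <> 0%nat -> bs x y = 1%nat).
  { intros x y Hx Hy E. specialize (N3 x y Hx Hy).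
    destruct (bs_spec x y) as [?|[[? _]|[? _]]]; congruence. }
  destruct (existsb (fun p => bsp p =? 1)%nat P) eqn:E1.
  2:{ exfalso. assert (cut a b <= list_sum (map bsp []))%nat; [|cbn in *; lia].
      apply cut_le; trivial. intros x y Hx Hy E.
      apply Bool.not_true_iff_false in E1; apply E1.
      apply existsb_exists. exists (x, y). split; [now apply in_prod|].
      apply Nat.eqb_eq. now apply V. }
  apply existsb_exists in E1 as ([x y] & Hp & E). apply Nat.eqb_eq in E.
  apply in_prod_iff in Hp as [Hx Hy]. cbn in E.
  (* Search for a second weak pair, different from [(x, y)]; if there is none, the whole cut has
     strength at most 1. *)
  destruct (existsb (fun p => (bsp p =? 1)%nat &&
     if cell_eq_dec x (fst p) then if cell_eq_dec y (snd p) then false else true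
     else true)%bool P) eqn:E2.
  - apply existsb_exists in E2 as ([x' y'] & Hp & E').
    apply in_prod_iff in Hp as [Hx' Hy'].
    apply Bool.andb_true_iff in E' as [E' E2]. apply Nat.eqb_eq in E'. cbn in *.
    exists x, y, x', y'. repeat split; auto. intros [= <- <-].
    destruct (cell_eq_dec x x); [destruct (cell_eq_dec y y)|]; congruence.
  - exfalso. assert (H : (cut a b <= list_sum (map bsp [(x, y)]))%nat).
    { apply cut_le; trivial. intros x' y' Hx' Hy' E'. left.
      apply Bool.not_true_iff_false in E2.
      destruct (cell_eq_dec x x') as [<-|Nx]; [destruct (cell_eq_dec y y') as [<-|Ny]|];
        trivial; exfalso; apply E2; apply existsb_exists.
      + exists (x, y'). split; [now apply in_prod|]. unfold bsp; cbn [fst snd].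
        rewrite (proj2 (Nat.eqb_eq _ _) (V _ _ Hx' Hy' E')).
        destruct (cell_eq_dec x x); [destruct (cell_eq_dec y y')|]; easy.
      + exists (x', y'). split; [now apply in_prod|]. unfold bsp; cbn [fst snd].
        rewrite (proj2 (Nat.eqb_eq _ _) (V _ _ Hx' Hy' E')).
        destruct (cell_eq_dec x x'); easy. }
    cbn in H. unfold bsp in H; cbn in H. lia.
Qed.

(** * Geometry of snakes *)

(** Index along the path modulo 6, continuing up to 8 in the odd end block, where
    [shift] and [offset] are taken relative to the first column of the block.  The
    values at [Row] are junk. *)
Definition phase (q : state) : Z :=
  match q with
  | M0 | Start => 0 | M1 => 1 | M2 => 2
  | M3 | O0 => 3 | M4 | O1 => 4 | M5 | EvenEnd | O2 => 5
  | O3 => 6 | O4 => 7 | O5 => 8 | Row => 0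
  end.
Definition row (q : state) : Z :=
  match q with
  | M0 | Start | M5 | EvenEnd | O4 | O5 => 2
  | M1 | M4 | O2 | O3 => 1
  | _ => 0
  end.
Definition odd_end (q : state) : bool :=
  match q with O0 | O1 | O2 | O3 | O4 | O5 => true | _ => false end.
Definition shift (q : state) : Z :=
  match q with O1 | O2 | O5 => 1 | _ => 0 end.
Definition offset (q : state) : Z :=
  match q with
  | M0 | Start | M3 | O0 => 0 | M1 | M4 | O1 => 1 | M2 | M5 | EvenEnd | O2 => 2
  | O3 => 3 | O4 => 4 | O5 => 5 | Row => 0
  end.

Definition bcol (x : cell) : Z := fst (fst x) - shift (snd x).
Definition bottom (x : cell) : Z := snd (fst x) - row (snd x).
Definition idx (x : cell) : Z := 3 * bcol x + offset (snd x).

(** A transitive consequence of [link] that already forces distinct positions, so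
    that snakes do not intersect themselves.  The third clause keeps track of the
    parity of columns; the last one records that the odd end block only comes
    after, and to the right of, everything else. *)
Definition prec (x y : cell) : Prop :=
  bottom x = bottom y /\ idx x < idx y /\
  (exists t, idx x - phase (snd x) - (idx y - phase (snd y)) = 6 * t) /\
  (if odd_end (snd x) then odd_end (snd y) = true /\ bcol x = bcol y
   else if odd_end (snd y) then bcol x < bcol y else True).

Lemma offset_bounds q : odd_end q = false -> 0 <= offset q <= 2.
Proof. destruct q; cbn; intros; try lia; discriminate. Qed.

Lemma prec_trans x y z : prec x y -> prec y z -> prec x z.
Proof.
  intros (A1 & A2 & (s & A3) & A4) (B1 & B2 & (t & B3) & B4).
  repeat split; [lia..|exists (s + t); lia|].
  destruct (odd_end (snd x)) eqn:Ex.
  - destruct A4 as [Ey A4]. rewrite Ey in B4. split; [easy|lia].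
  - destruct (odd_end (snd z)) eqn:Ez; trivial.
    destruct (odd_end (snd y)) eqn:Ey; [lia|].
    (* Both offsets lie between 0 and 2, so [idx x < idx y] gives [bcol x <= bcol y], and
       [bcol y < bcol z]. *)
    apply offset_bounds in Ex, Ey. unfold idx in *. lia.
Qed.

Ltac cbst := cbn [shift offset phase row odd_end step fst snd] in *.

Lemma link_prec x y : link x y -> prec x y.
Proof.
  destruct x as [[a b] q], y as [[c d] r].
  unfold link, prec, idx, bcol, bottom; cbn [fst snd].
  intros (H & -> & ->).
  destruct q, r; try discriminate H; cbst; repeat split; try lia;
    first [exists 0; lia | exists (-1); lia | exists 1; lia].
Qed.

Lemma link_idx x y : link x y -> idx y = idx x + 1.
Proof.
  destruct x as [[a b] q], y as [[c d] r].
  unfold link, idx, bcol; cbn [fst snd].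
  intros (H & -> & ->).
  destruct q, r; try discriminate H; cbst; lia.
Qed.

(** At a common position the rows agree. Two states of the periodic part are then excluded by the
    order of [idx] or by column parity, two states of the end block are told apart by [row] and
    [shift], and a mixed pair is separated by [bcol]. *)
Lemma prec_pos x y : snd x <> Row -> snd y <> Row -> prec x y -> fst x <> fst y.
Proof.
  destruct x as [[a b] q], y as [[c d] r].
  unfold prec, idx, bcol, bottom; cbn [fst snd].
  intros Hq Hr (A1 & A2 & (t & A3) & A4) [= -> ->].
  destruct q, r; try congruence; cbst; lia.
Qed.

(** * Chains of linked cells *)

Lemma Sorted_app_inv {A} (R : A -> A -> Prop) l m :
  Sorted R (l ++ m) -> Sorted R l /\ Sorted R m.
Proof.
  induction l as [|x l IH]; cbn; [auto|]. intros H; inversion H; subst.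
  destruct (IH H2). split; trivial. constructor; trivial.
  destruct l; constructor. now inversion H3.
Qed.

Lemma Sorted_adjacent {A} (R : A -> A -> Prop) l x y m :
  Sorted R (l ++ x :: y :: m) -> R x y.
Proof.
  intros H. apply Sorted_app_inv in H as [_ H].
  inversion H; subst. now inversion H3.
Qed.

Lemma Sorted_join {A} (R : A -> A -> Prop) l x y m :
  Sorted R (l ++ [x]) -> Sorted R (y :: m) -> R x y ->
  Sorted R ((l ++ [x]) ++ y :: m).
Proof.
  intros H Hm Hxy; induction l as [|z l IH]; cbn in *.
  - constructor; trivial. now constructor.
  - inversion H; subst. constructor; auto.
    destruct l; cbn in *; constructor; now inversion H3.
Qed.

Lemma StronglySorted_app {A} (R : A -> A -> Prop) l m x y :
  StronglySorted R (l ++ m) -> In x l -> In y m -> R x y.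
Proof.
  intros H Hx Hy; induction l as [|z l IH]; cbn in *; [easy|].
  inversion H; subst. destruct Hx as [->|Hx]; auto.
  rewrite Forall_forall in H3. apply H3, in_app_iff; auto.
Qed.

(** A discrete intermediate value principle; it locates the place where a path crosses a cut. *)
Lemma switch {A} (P Q : A -> Prop) (l : list A) x w :
  (forall z, In z l -> P z \/ Q z) -> P x -> In w l -> Q w ->
  exists l1 u v l2, x :: l = l1 ++ u :: v :: l2 /\ P u /\ Q v.
Proof.
  revert x; induction l as [|y l IH]; intros x H Hx Hw HQ; [easy|].
  destruct (H y (or_introl eq_refl)) as [Py|Qy].
  - destruct Hw as [->|Hw]; [exists [], x, w, l; auto|].
    destruct (IH y) as (l1 & u & v & l2 & E & ?); auto with datatypes.
    exists (x :: l1), u, v, l2. now rewrite E.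
  - exists [], x, y, l; auto.
Qed.

Lemma pos_inj (c : list cell) x y :
  NoDup (map fst c) -> In x c -> In y c -> fst x = fst y -> x = y.
Proof.
  induction c as [|z c IH]; cbn; [easy|].
  intros H Hx Hy E; inversion H; subst.
  destruct Hx as [->|Hx], Hy as [->|Hy]; auto.
  - destruct H2. rewrite E. now apply in_map.
  - destruct H2. rewrite <- E. now apply in_map.
Qed.

Definition chain (l : list cell) : Prop :=
  Sorted link l /\ Forall (fun x => snd x <> Row) l.

Lemma chain_app_inv l m : chain (l ++ m) -> chain l /\ chain m.
Proof.
  intros [H1 H2]. apply Sorted_app_inv in H1. apply Forall_app in H2.
  unfold chain. tauto.
Qed.

Lemma chain_adjacent l x y m : chain (l ++ x :: y :: m) -> link x y.
Proof. intros [H _]. now apply Sorted_adjacent in H. Qed.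

Lemma chain_not_Row l x : chain l -> In x l -> snd x <> Row.
Proof. intros [_ H]. rewrite Forall_forall in H. auto. Qed.

Lemma chain_prec l : chain l -> StronglySorted prec l.
Proof.
  intros [H _]. apply Sorted_StronglySorted; [exact prec_trans|].
  induction H as [|x l Hl IH Hx]; constructor; trivial.
  inversion Hx; constructor. now apply link_prec.
Qed.

Lemma chain_app_prec l m x y : chain (l ++ m) -> In x l -> In y m -> prec x y.
Proof. intros H. now apply StronglySorted_app, chain_prec. Qed.

Lemma chain_NoDup l : chain l -> NoDup (map fst l).
Proof.
  induction l as [|x l IH]; intros H; cbn; constructor.
  - intros Hin. apply in_map_iff in Hin as (y & E & Hy).
    apply (prec_pos x y); auto.
    + apply (chain_not_Row (x :: l)); auto with datatypes.
    + apply (chain_not_Row (x :: l)); auto with datatypes.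
    + apply (chain_app_prec [x] l); auto with datatypes.
  - apply IH. now apply (chain_app_inv [x] l).
Qed.

(** [step] depends on the source state alone, so even at a branching the next position is
    determined. *)
Lemma link_target x y y' : link x y -> link x y' -> fst y = fst y'.
Proof.
  destruct y as [[a b] r], y' as [[c d] r']. unfold link; cbn.
  intros (_ & -> & ->) (_ & -> & ->). reflexivity.
Qed.

(** The only state with two predecessors is [M1], and both [M0] and [Start] reach it by a downward
    step. *)
Lemma link_source x y y' : link y x -> link y' x -> fst y = fst y'.
Proof.
  destruct x as [[m n] q], y as [[a b] r], y' as [[c d] r']. unfold link; cbn.
  intros (H & A1 & A2) (H' & B1 & B2).
  destruct q, r; try discriminate H; destruct r'; try discriminate H';
    cbn in *; f_equal; lia.
Qed.

Lemma link_not_Row x y : link x y -> snd x <> Row /\ snd y <> Row.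
Proof. intros (H & _). destruct (snd x), (snd y); try discriminate H; easy. Qed.

Definition closed_end (q : state) : Prop := q = EvenEnd \/ q = O5.

Lemma link_Start x y : link x y -> snd y <> Start.
Proof. intros (H & _) E. rewrite E in H. destruct (snd x); discriminate. Qed.

Lemma link_closed x y : link x y -> ~ closed_end (snd x).
Proof. intros (H & _) [E|E]; rewrite E in H; discriminate. Qed.

(** If [x] had a successor in [l], that cell would occupy the position of [y]. *)
Lemma chain_last_of l x y :
  chain l -> In x l -> link x y -> ~ In (fst y) (map fst l) ->
  exists l', l = l' ++ [x].
Proof.
  intros Hl Hx Hxy Hy. apply in_split in Hx as (l1 & [|z l2] & ->); [eauto|].
  destruct Hy. apply chain_adjacent in Hl.
  rewrite (link_target _ _ _ Hxy Hl). apply in_map, in_app_iff; cbn; auto.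
Qed.

Lemma chain_first_of l x y :
  chain l -> In x l -> link y x -> ~ In (fst y) (map fst l) ->
  exists l', l = x :: l'.
Proof.
  intros Hl Hx Hxy Hy. apply in_split in Hx as (l1 & l2 & ->).
  destruct l1 as [|z l1 _] using rev_ind; [eexists; reflexivity|].
  destruct Hy. rewrite <- app_assoc in Hl. apply chain_adjacent in Hl.
  rewrite (link_source _ _ _ Hxy Hl). apply in_map.
  rewrite !in_app_iff; cbn; auto.
Qed.

Lemma chain_Start l x : chain l -> In x l -> snd x = Start -> exists l', l = x :: l'.
Proof.
  intros Hl Hx E. apply in_split in Hx as (l1 & l2 & ->).
  destruct l1 as [|z l1 _] using rev_ind; [eexists; reflexivity|].
  rewrite <- app_assoc in Hl. apply chain_adjacent in Hl.
  now apply link_Start in Hl.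
Qed.

Lemma chain_closed_end l x :
  chain l -> In x l -> closed_end (snd x) -> exists l', l = l' ++ [x].
Proof.
  intros Hl Hx E. apply in_split in Hx as (l1 & [|z l2] & ->); [eauto|].
  apply chain_adjacent in Hl. now apply link_closed in Hl.
Qed.

(** * Complete snakes *)

Definition full (l : list cell) (f e : cell) : Prop :=
  chain l /\ (exists r, l = f :: r) /\ (exists r, l = r ++ [e]) /\
  snd f = Start /\ closed_end (snd e).

Lemma full_first l f e : full l f e -> In f l.
Proof. intros (_ & (r & ->) & _). cbn; auto. Qed.

Lemma full_last l f e : full l f e -> In e l.
Proof. intros (_ & _ & (r & ->) & _). apply in_app_iff; cbn; auto. Qed.

Lemma full_first_neq_last l f e : full l f e -> f <> e.
Proof. intros (_ & _ & _ & H1 & H2) ->. rewrite H1 in H2. now destruct H2. Qed.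

Lemma pos_eq_dec (p q : pos) : {p = q} + {p <> q}.
Proof. repeat decide equality. Qed.

(** The two ends have no link leading outwards, and every other link from a cell of [l] leads to the
    position of its neighbour in the chain. *)
Lemma full_closed l f e u v :
  full l f e -> In u l -> link u v \/ link v u -> In (fst v) (map fst l).
Proof.
  intros (Hl & (r & Hr) & (r' & Hr') & Hf & He) Hu Huv.
  destruct (in_dec pos_eq_dec (fst v) (map fst l))
    as [?|N]; trivial; exfalso.
  destruct Huv as [H|H].
  - destruct (chain_last_of l u v) as (l' & E); trivial.
    rewrite Hr' in E. apply app_inj_tail in E as [_ ->]. now apply link_closed in H.
  - destruct (chain_first_of l u v) as (l' & E); trivial.
    rewrite Hr in E. injection E as -> ->. now apply link_Start in H.
Qed.

Lemma full_contact l f e x :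
  full l f e -> In x l -> contact (snd x) = true -> x = f \/ x = e.
Proof.
  intros (Hl & (r & Hr) & (r' & Hr') & _) Hx Hc.
  destruct (snd x) eqn:E; try discriminate Hc; [left|right|right].
  - destruct (chain_Start l x) as (l' & E'); trivial. congruence.
  - destruct (chain_closed_end l x) as (l' & E'); trivial; [left; trivial|].
    rewrite Hr' in E'. now apply app_inj_tail in E'.
  - destruct (chain_closed_end l x) as (l' & E'); trivial; [right; trivial|].
    rewrite Hr' in E'. now apply app_inj_tail in E'.
Qed.

(** [Start] has no predecessor and a closing state has no successor. Hence a contact cell is an end
    of its chain, and two different contact cells are its two ends. *)
Lemma chain_contacts_full l x y :
  chain l -> In x l -> In y l -> x <> y ->
  contact (snd x) = true -> contact (snd y) = true ->
  full l x y \/ full l y x.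
Proof.
  intros Hl Hx Hy Hn Cx Cy.
  assert (K : forall q, contact q = true -> q = Start \/ closed_end q)
    by (intros []; cbn; unfold closed_end; auto; discriminate).
  destruct (K _ Cx) as [Ex|Ex], (K _ Cy) as [Ey|Ey].
  - destruct (chain_Start l x), (chain_Start l y); trivial; congruence.
  - left. destruct (chain_Start l x), (chain_closed_end l y); trivial.
    repeat split; eauto; apply Hl.
  - right. destruct (chain_Start l y), (chain_closed_end l x); trivial.
    repeat split; eauto; apply Hl.
  - destruct (chain_closed_end l x) as (m & E), (chain_closed_end l y) as (m' & E');
      trivial. rewrite E in E'. now apply app_inj_tail in E'.
Qed.

(** * Cuts of a chain *)

Lemma chain_cross l1 x l2 w (a b : list cell) :
  chain (l1 ++ x :: l2) -> (forall z, In z (x :: l2) -> In z a \/ In z b) ->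
  In x a -> In w l2 -> In w b ->
  exists u v, In u a /\ In v b /\ bs u v = 3%nat /\ bs v u = 3%nat /\
              In u (x :: l2) /\ In v l2.
Proof.
  intros Hl Hc Hx Hw Hwb.
  destruct (switch (fun z => In z a) (fun z => In z b) l2 x w)
    as (m1 & u & v & m2 & E & Hu & Hv); auto with datatypes.
  rewrite E in Hl. rewrite app_assoc in Hl. apply chain_adjacent in Hl.
  exists u, v. rewrite (bs_sym v u), (bs_link u v Hl). repeat split; trivial.
  - rewrite E. apply in_app_iff; cbn; auto.
  - destruct m1; cbn in E; injection E as -> ->; cbn; auto.
    apply in_app_iff; cbn; auto.
Qed.

(** A cut of strength at most 3 crosses only one link. The chain crosses from [a] to [b] at some
    [u], [v]; any cell on the wrong side before or after this link would force another crossed link,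
    for a total of 6. *)
Lemma snake_break_from l f r a b :
  chain l -> l = f :: r ->
  (forall z, In z l <-> In z a \/ In z b) -> (forall z, In z a -> ~ In z b) ->
  NoDup a -> NoDup b -> b <> [] -> (cut a b <= 3)%nat -> In f a ->
  exists l1 l2, l = l1 ++ l2 /\ Permutation a l1 /\ Permutation b l2.
Proof.
  intros Hl El Hc Hdis Na Nb Hb Hcut Hf.
  assert (Nl := NoDup_map_inv fst l (chain_NoDup l Hl)).
  destruct b as [|w b']; [easy|]. set (b := w :: b') in *.
  assert (Hwb : In w b) by (left; trivial).
  assert (Hw : In w r).
  { assert (In w l) as Hw by (apply Hc; auto). rewrite El in Hw.
    destruct Hw as [->|]; trivial. now apply Hdis in Hf. }
  destruct (switch (fun z => In z a) (fun z => In z b) r f w)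
    as (l1 & u & v & l2 & E & Hu & Hv); trivial.
  { intros z Hz. apply Hc. rewrite El. now right. }
  rewrite <- El in E.
  assert (E' : l = (l1 ++ [u]) ++ v :: l2) by now rewrite <- app_assoc.
  assert (Huv : bs u v = 3%nat) by (apply bs_link; rewrite E in Hl; now apply chain_adjacent in Hl).
  rewrite E' in Hl, Nl.
  assert (Dj : forall z, In z (l1 ++ [u]) -> ~ In z (v :: l2)).
  { intros z Hz Hz'. apply in_split in Hz' as (m1 & m2 & Em).
    rewrite Em in Nl. rewrite app_assoc in Nl. apply NoDup_remove_2 in Nl.
    apply Nl. rewrite !in_app_iff in *. tauto. }
  (* A cell of [b] before [u] gives a crossing from [b] back to [a] within the prefix, distinct from
     the link between [u] and [v]. *)
  assert (A1 : forall z, In z (l1 ++ [u]) -> In z a).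
  { intros z Hz. destruct (proj1 (Hc z)) as [?|Hzb]; trivial;
      [rewrite E'; rewrite in_app_iff; auto|exfalso].
    apply in_app_iff in Hz as [Hz|[->|[]]]; [|now apply Hdis in Hu].
    apply in_split in Hz as (m1 & m2 & ->).
    destruct (chain_cross m1 z (m2 ++ [u]) u b a) as (v' & u' & ? & ? & ? & ? & ? & ?);
      rewrite ?in_app_iff; cbn; auto.
    - apply chain_app_inv in Hl as [Hl _]. now rewrite app_comm_cons, app_assoc.
    - intros y Hy. apply or_comm, Hc. rewrite E'.
      apply in_app_iff; left. rewrite <- app_assoc. apply in_app_iff; right; exact Hy.
    - assert (6 <= cut a b)%nat; [|lia].
      replace 6%nat with (bs u v + bs u' v')%nat by lia.
      apply cut_two; trivial. intros [= <- <-].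
      apply (Dj v); [|now left].
      cbn in H3; rewrite !in_app_iff in *; cbn; tauto. }
  assert (A2 : forall z, In z (v :: l2) -> In z b).
  { intros z Hz. destruct (proj1 (Hc z)) as [Hza|?]; trivial;
      [rewrite E'; rewrite in_app_iff; auto|exfalso].
    destruct Hz as [->|Hz]; [now apply Hdis in Hv|].
    destruct (chain_cross (l1 ++ [u]) v l2 z b a) as (v' & u' & ? & ? & ? & ? & ? & ?);
      trivial.
    - intros y Hy. apply or_comm, Hc. rewrite E', in_app_iff; auto.
    - assert (6 <= cut a b)%nat; [|lia].
      replace 6%nat with (bs u v + bs u' v')%nat by lia.
      apply cut_two; trivial. intros [= <- <-].
      apply (Dj u); [apply in_app_iff; cbn; auto|now right]. }
  exists (l1 ++ [u]), (v :: l2). repeat split; trivial.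
  - apply NoDup_Permutation; trivial; [now apply NoDup_app_remove_r in Nl|].
    intros z; split; auto. intros Hz.
    assert (Hz' : In z l) by (apply Hc; auto).
    rewrite E', in_app_iff in Hz'. destruct Hz' as [|Hz']; trivial.
    now apply A2, Hdis in Hz'.
  - apply NoDup_Permutation; trivial; [now apply NoDup_app_remove_l in Nl|].
    intros z; split; auto. intros Hz.
    assert (Hz' : In z l) by (apply Hc; auto).
    rewrite E', in_app_iff in Hz'. destruct Hz' as [Hz'|]; trivial.
    now apply A1, Hdis in Hz'.
Qed.

Lemma snake_break l a b :
  chain l ->
  (forall z, In z l <-> In z a \/ In z b) -> (forall z, In z a -> ~ In z b) ->
  NoDup a -> NoDup b -> a <> [] -> b <> [] -> (cut a b <= 3)%nat ->
  exists l1 l2, l = l1 ++ l2 /\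
    (Permutation a l1 /\ Permutation b l2 \/ Permutation a l2 /\ Permutation b l1).
Proof.
  intros Hl Hc Hdis Na Nb Ha Hb Hcut.
  destruct l as [|f r].
  { destruct a as [|x a]; [easy|]. destruct (proj2 (Hc x)). left; now left. }
  destruct (proj1 (Hc f) (or_introl eq_refl)) as [Hf|Hf].
  - destruct (snake_break_from (f :: r) f r a b) as (l1 & l2 & ? & ?); trivial.
    exists l1, l2; tauto.
  - destruct (snake_break_from (f :: r) f r b a) as (l1 & l2 & ? & ? & ?); trivial.
    + intros z. now rewrite Hc, or_comm.
    + intros z H1 H2. now apply Hdis in H2.
    + now rewrite cut_sym.
    + exists l1, l2; tauto.
Qed.

Lemma chain_cut l a b :
  chain l ->
  (forall z, In z l <-> In z a \/ In z b) -> (forall z, In z a -> ~ In z b) ->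
  a <> [] -> b <> [] -> (3 <= cut a b)%nat.
Proof.
  intros Hl Hc Hdis Ha Hb.
  assert (K : forall f r a b, l = f :: r ->
    (forall z, In z l <-> In z a \/ In z b) -> (forall z, In z a -> ~ In z b) ->
    b <> [] -> In f a -> (3 <= cut a b)%nat).
  { clear a b Hc Hdis Ha Hb. intros f r a b -> Hc Hdis Hb Hf.
    destruct b as [|w b]; [easy|].
    destruct (chain_cross [] f r w a (w :: b)) as (u & v & Hu & Hv & E & _); trivial.
    - intros z; apply Hc.
    - destruct (proj2 (Hc w)) as [->|]; trivial; [right; now left|].
      exfalso; apply (Hdis w); trivial; now left.
    - now left.
    - rewrite <- E. now apply cut_one. }
  destruct l as [|f r].
  { destruct a as [|x a]; [easy|]. destruct (proj2 (Hc x)). left; now left. }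
  destruct (proj1 (Hc f) (or_introl eq_refl)) as [Hf|Hf].
  - now apply (K f r a b).
  - rewrite cut_sym. apply (K f r b a); trivial.
    + intros z. now rewrite Hc, or_comm.
    + intros z H1 H2. now apply Hdis in H2.
Qed.

(** * The invariant and combinations *)

Definition snake (c : list cell) : Prop :=
  exists l, l <> [] /\ chain l /\ Permutation c l.

(** The row is an interval at height [y0], possibly with no snake attached. Snakes are recorded cell
    by cell instead of as a list, so that unions and parts are handled pointwise. *)
Definition comb (c : list cell) : Prop :=
  exists y0,
    (exists x, In ((x, y0), Row) c) /\
    (forall x y, In ((x, y), Row) c -> y = y0) /\
    (forall x1 x2 x3, x1 <= x2 <= x3 -> In ((x1, y0), Row) c ->
       In ((x3, y0), Row) c -> In ((x2, y0), Row) c) /\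
    (forall z, In z c -> snd z <> Row -> exists l f e, full l f e /\ In z l /\
       incl l c /\ In (above f) c /\ In (above e) c).

Definition good (c : list cell) : Prop :=
  NoDup (map fst c) /\ (snake c \/ comb c).

Lemma comb_same c c' : (forall z, In z c <-> In z c') -> comb c -> comb c'.
Proof.
  intros H (y0 & (x & H1) & H2 & H3 & H4). exists y0. repeat split.
  - exists x. now apply H.
  - intros x' y Hx. eapply H2, H, Hx.
  - intros x1 x2 x3 Hx A1 A2. apply H in A1, A2. apply H. eauto.
  - intros z Hz Hn. destruct (H4 z) as (l & f & e & A1 & A2 & A3 & A4 & A5); trivial.
    { now apply H. }
    exists l, f, e. split; [trivial|]. repeat split; trivial; try now apply H.
    + intros u Hu. now apply H, A3.
Qed.

Lemma in_map_fst (x : cell) (c : list cell) :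
  In (fst x) (map fst c) -> exists y, In y c /\ fst y = fst x.
Proof. intros H. apply in_map_iff in H as (y & ? & ?). eauto. Qed.

Lemma snake_not_Row c z : snake c -> In z c -> snd z <> Row.
Proof.
  intros (l & _ & Hl & P) Hz. apply (chain_not_Row l); trivial.
  now apply (Permutation_in _ P).
Qed.

(** Path cells of a comb lie in complete snakes, which are closed under links; so nothing outside
    the comb can be linked to it. *)
Lemma comb_strong c x y :
  comb c -> In y c -> link x y \/ link y x -> exists z, In z c /\ fst z = fst x.
Proof.
  intros (y0 & _ & _ & _ & H) Hy Hxy.
  destruct (H y) as (l & f & e & Hl & Hin & Hi & _); trivial.
  { destruct Hxy as [K|K]; now apply link_not_Row in K. }
  destruct (in_map_fst x l) as (z & Hz & E).
  { apply (full_closed l f e y); tauto. }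
  exists z; auto.
Qed.

Lemma comb_above c x : comb c -> In x c -> contact (snd x) = true -> In (above x) c.
Proof.
  intros (y0 & _ & _ & _ & H) Hx Hc.
  destruct (H x) as (l & f & e & Hl & Hin & Hi & H1 & H2); trivial.
  { now destruct (snd x). }
  now destruct (full_contact l f e x) as [->| ->].
Qed.

Definition apart (a b : list cell) : Prop :=
  forall x y, In x a -> In y b -> fst x <> fst y.

Lemma apart_sym a b : apart a b -> apart b a.
Proof. intros H x y Hx Hy E. now apply (H y x). Qed.

(** A strong bond would be a link to a position already occupied in the comb. So there are two
    contacts, which lie at different cells of the snake and therefore make it complete, with both
    ends under the row. *)
Lemma combine_snake_comb a b :
  snake a -> comb b -> NoDup a -> NoDup b -> apart a b ->
  (2 <= cut a b)%nat -> comb (a ++ b).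
Proof.
  intros Ha Hb Na Nb D Hcut.
  apply cut_ge2 in Hcut as [(x & y & Hx & Hy & E)|
    (x & y & x' & y' & Hx & Hy & Hx' & Hy' & E & E' & N)]; trivial.
  - exfalso. destruct (bs_spec x y) as [?|[[_ H]|[? _]]]; try congruence.
    assert (link x y \/ link y x) as K.
    { destruct H as [?|[?|(K & _)]]; auto. now apply (snake_not_Row a) in K. }
    destruct (comb_strong b x y) as (z & Hz & Ez); trivial.
    now apply (D x z).
  - assert (K : forall x y, In x a -> In y b -> bs x y = 1%nat -> hang x y).
    { clear - Ha. intros x y Hx Hy E.
      destruct (bs_spec x y) as [?|[[? _]|[_ [?|[_ K]]]]]; trivial; try congruence.
      apply (snake_not_Row a) in Hx; trivial. now rewrite K in Hx. }
    destruct (K x y) as [Cx ->]; trivial. destruct (K x' y') as [Cx' ->]; trivial.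
    assert (x <> x') by (intros ->; now apply N).
    destruct Ha as (l & _ & Hl & P).
    assert (F : exists f e, full l f e /\ In (above f) b /\ In (above e) b).
    { destruct (chain_contacts_full l x x') as [F|F]; eauto;
        eapply Permutation_in; eauto. }
    destruct F as (f & e & F & F1 & F2).
    destruct Hb as (y0 & (x0 & H1) & H2 & H3 & H4).
    assert (Z : forall p, In (p, Row) (a ++ b) -> In (p, Row) b).
    { intros p Hp. apply in_app_iff in Hp as [Hp|]; trivial.
      apply (Permutation_in _ P), (chain_not_Row l) in Hp; trivial. now destruct Hp. }
    exists y0. repeat split.
    + exists x0. apply in_app_iff; auto.
    + intros u v Hu. eapply H2; eauto.
    + intros x1 x2 x3 Hxs A1 A2. apply in_app_iff; right. eauto.
    + intros z Hz Hn. apply in_app_iff in Hz as [Hz|Hz].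
      * exists l, f, e. split; trivial. repeat split; try (apply in_app_iff; auto).
        -- now apply (Permutation_in _ P).
        -- intros u Hu. apply in_app_iff; left.
           now apply (Permutation_in _ (Permutation_sym P)).
      * destruct (H4 z) as (l' & f' & e' & A1 & A2 & A3 & A4 & A5); trivial.
        exists l', f', e'. split; trivial. repeat split; try (apply in_app_iff; auto);
          trivial. intros u Hu. apply in_app_iff; auto.
Qed.

(** Any bond between the two is a row bond: links lead to occupied positions, and each contact of a
    hung snake is already covered by its own row. The two rows are then adjacent disjoint
    intervals. *)
Lemma combine_comb_comb a b :
  comb a -> comb b -> NoDup a -> NoDup b -> apart a b ->
  (2 <= cut a b)%nat -> comb (a ++ b).
Proof.
  intros Ha Hb Na Nb D Hcut.
  assert (K : exists x y, In x a /\ In y b /\ rowlink x y).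
  { assert (K : exists x y, In x a /\ In y b /\ bs x y <> 0%nat).
    { apply cut_ge2 in Hcut as [(x & y & Hx & Hy & E)|
        (x & y & _ & _ & Hx & Hy & _ & _ & E & _)]; trivial;
        exists x, y; repeat split; trivial; congruence. }
    destruct K as (x & y & Hx & Hy & E). exists x, y. repeat split; trivial;
    destruct (bs_spec x y) as [?|[[_ [H|[H|H]]]|[_ [H|H]]]]; try (easy || apply H);
      exfalso.
    all: try (destruct (comb_strong b x y) as (z & Hz & Ez); auto; now apply (D x z)).
    all: destruct H as [Hc ->];
      first [ now apply (D (above x) (above x)); auto using comb_above
            | now apply (D (above y) (above y)); auto using comb_above ]. }
  destruct K as ([[u v] q] & [[u' v'] q'] & Hx & Hy & (E1 & E2 & E3 & E4)).
  cbn in *; subst q q' v'.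
  destruct Ha as (y0 & _ & A2 & A3 & A4), Hb as (y1 & _ & B2 & B3 & B4).
  assert (v = y0) by eauto. assert (v = y1) by eauto. subst y0 y1.
  assert (Nab : forall x, In ((x, v), Row) a -> In ((x, v), Row) b -> False).
  { intros x H1 H2. now apply (D _ _ H1 H2). }
  exists v. repeat split.
  - exists u. apply in_app_iff; auto.
  - intros x y H. apply in_app_iff in H as [H|H]; eauto.
  - intros x1 x2 x3 Hxs H1 H3. rewrite in_app_iff in *.
    (* Stated for arbitrary [a] and [b], with either one on the left, to serve both mixed cases
       below. *)
    assert (G : forall a b u u', 
      (forall x1 x2 x3 : Z, x1 <= x2 <= x3 -> In (x1, v, Row) a -> In (x3, v, Row) a -> In (x2, v, Row) a) ->
      (forall x1 x2 x3 : Z, x1 <= x2 <= x3 -> In (x1, v, Row) b -> In (x3, v, Row) b -> In (x2, v, Row) b) ->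
      (forall x, In ((x, v), Row) a -> In ((x, v), Row) b -> False) ->
      (u' = u + 1 \/ u' = u - 1) -> In ((u, v), Row) a -> In ((u', v), Row) b ->
      In (x1, v, Row) a -> In (x3, v, Row) b -> In (x2, v, Row) a \/ In (x2, v, Row) b).
    { clear - Hxs. intros a b u u' A B N [-> | ->] Hu Hu' H1 H3.
      - destruct (Z_le_gt_dec x1 u).
        + destruct (Z_le_gt_dec x2 u); [left; apply (A x1 x2 u)|]; trivial; try lia.
          destruct (Z_le_gt_dec (u + 1) x3); [right; apply (B (u + 1) x2 x3)|];
            trivial; lia.
        + destruct (N (u + 1)); trivial. apply (A u (u + 1) x1); trivial; lia.
      - destruct (Z_le_gt_dec x1 (u - 1)).
        + destruct (N (u - 1)); trivial. apply (A x1 (u - 1) u); trivial; lia.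
        + destruct (N u); trivial. apply (B (u - 1) u x3); trivial; lia. }
    destruct H1 as [H1|H1], H3 as [H3|H3].
    + left; eauto.
    + apply (G a b u u'); trivial.
    + apply or_comm, (G b a u' u); trivial; try lia. intros x ? ?; eauto.
    + right; eauto.
  - intros z Hz Hn. apply in_app_iff in Hz as [Hz|Hz].
    + destruct (A4 z) as (l' & f' & e' & F1 & F2 & F3 & F4 & F5); trivial.
      exists l', f', e'. split; trivial. repeat split; try (apply in_app_iff; auto);
        trivial. intros w Hw. apply in_app_iff; auto.
    + destruct (B4 z) as (l' & f' & e' & F1 & F2 & F3 & F4 & F5); trivial.
      exists l', f', e'. split; trivial. repeat split; try (apply in_app_iff; auto);
        trivial. intros w Hw. apply in_app_iff; auto.
Qed.

(** Contacts and row bonds involve a row tile, so the bond is a link. Its target and source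
    positions are free in the respective other snake, so it runs from the last cell of one to the
    first cell of the other. *)
Lemma combine_snake_snake a b :
  snake a -> snake b -> NoDup a -> NoDup b -> apart a b ->
  (2 <= cut a b)%nat -> snake (a ++ b).
Proof.
  intros Ha Hb Na Nb D Hcut.
  assert (K : exists x y, In x a /\ In y b /\ (link x y \/ link y x)).
  { assert (K : exists x y, In x a /\ In y b /\ bs x y <> 0%nat).
    { apply cut_ge2 in Hcut as [(x & y & Hx & Hy & E)|
        (x & y & _ & _ & Hx & Hy & _ & _ & E & _)]; trivial;
        exists x, y; repeat split; trivial; congruence. }
    destruct K as (x & y & Hx & Hy & E). exists x, y. repeat split; trivial.
    apply snake_not_Row in Hx as Zx; trivial. apply snake_not_Row in Hy as Zy; trivial.
    destruct (bs_spec x y) as [?|[[_ [H|[H|H]]]|[_ [H|H]]]]; auto; try easy;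
      exfalso; destruct H as [H1 H2]; [easy| |]; rewrite H2 in *; easy. }
  destruct K as (x & y & Hx & Hy & K).
  destruct Ha as (l & L1 & L2 & P), Hb as (m & M1' & M2' & Q).
  assert (Dx : ~ In (fst y) (map fst l)).
  { intros H. apply in_map_fst in H as (z & Hz & E). apply (D z y); trivial.
    now apply (Permutation_in _ (Permutation_sym P)). }
  assert (Dy : ~ In (fst x) (map fst m)).
  { intros H. apply in_map_fst in H as (z & Hz & E). apply (D x z); auto.
    now apply (Permutation_in _ (Permutation_sym Q)). }
  apply (Permutation_in _ P) in Hx. apply (Permutation_in _ Q) in Hy.
  destruct K as [K|K].
  - destruct (chain_last_of l x y) as (l' & ->); trivial.
    destruct (chain_first_of m y x) as (m' & ->); trivial.
    exists ((l' ++ [x]) ++ y :: m'). repeat split.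
    + now destruct l'.
    + apply Sorted_join; trivial; [apply L2|apply M2'].
    + apply Forall_app; split; [apply L2|apply M2'].
    + now apply Permutation_app.
  - destruct (chain_last_of m y x) as (m' & ->); trivial.
    destruct (chain_first_of l x y) as (l' & ->); trivial.
    exists ((m' ++ [y]) ++ x :: l'). repeat split.
    + now destruct m'.
    + apply Sorted_join; trivial; [apply M2'|apply L2].
    + apply Forall_app; split; [apply M2'|apply L2].
    + rewrite Permutation_app_comm. now apply Permutation_app.
Qed.

Lemma apart_NoDup (a b : list cell) :
  NoDup (map fst a) -> NoDup (map fst b) -> apart a b -> NoDup (map fst (a ++ b)).
Proof.
  intros Ha Hb D. rewrite map_app. apply NoDup_app; trivial.
  intros p H1 H2. apply in_map_iff in H1 as (x & <- & Hx), H2 as (y & E & Hy).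
  now apply (D x y).
Qed.

Lemma good_NoDup c : good c -> NoDup c.
Proof. intros [H _]. exact (NoDup_map_inv fst c H). Qed.

Lemma good_combine a b :
  good a -> good b -> apart a b -> (2 <= cut a b)%nat -> good (a ++ b).
Proof.
  intros Ga Gb D Hcut.
  assert (Na := good_NoDup a Ga). assert (Nb := good_NoDup b Gb).
  destruct Ga as [Pa Ga], Gb as [Pb Gb].
  split; [now apply apart_NoDup|].
  destruct Ga as [Ga|Ga], Gb as [Gb|Gb].
  - left. now apply combine_snake_snake.
  - right. now apply combine_snake_comb.
  - right. apply (comb_same (b ++ a)).
    + intros z. rewrite !in_app_iff. tauto.
    + apply combine_snake_comb; trivial; [now apply apart_sym|now rewrite cut_sym].
  - right. now apply combine_comb_comb.
Qed.

(** * The invariant and breaks *)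

(** The bound 3 holds for every break, since a break needs strength below [temp] and [temp] never
    exceeds 4. *)
Definition light_cut (c a b : list cell) : Prop :=
  NoDup (map fst c) /\ Permutation c (a ++ b) /\ (cut a b <= 3)%nat.

Lemma light_cut_sym c a b : light_cut c a b -> light_cut c b a.
Proof.
  intros (H1 & H2 & H3). repeat split; trivial.
  - now rewrite Permutation_app_comm.
  - now rewrite cut_sym.
Qed.

Lemma light_cut_in c a b z : light_cut c a b -> In z c <-> In z a \/ In z b.
Proof.
  intros (_ & P & _). rewrite <- in_app_iff.
  split; apply Permutation_in; [|symmetry]; trivial.
Qed.

Lemma light_cut_NoDup c a b : light_cut c a b -> NoDup (a ++ b).
Proof.
  intros (N & P & _). apply (Permutation_NoDup P). exact (NoDup_map_inv fst c N).
Qed.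

Lemma light_cut_disjoint c a b z : light_cut c a b -> In z a -> In z b -> False.
Proof.
  intros H Ha Hb. apply light_cut_NoDup in H.
  apply in_split in Ha as (a1 & a2 & ->).
  rewrite <- app_assoc in H. apply NoDup_remove_2 in H. apply H.
  rewrite !in_app_iff; auto.
Qed.

Lemma light_cut_pairs c a b x y x' y' :
  light_cut c a b -> In x a -> In y b -> In x' a -> In y' b ->
  (x, y) <> (x', y') -> (bs x y + bs x' y' <= 3)%nat.
Proof.
  intros (_ & _ & H) Hx Hy Hx' Hy' N.
  assert (K := cut_two a b x y x' y' Hx Hy Hx' Hy' N). lia.
Qed.

Lemma row_switch (P Q : Z -> Prop) n x :
  P x -> Q (x + Z.of_nat n) -> (forall t, P t -> Q t -> False) ->
  (forall t, x <= t <= x + Z.of_nat n -> P t \/ Q t) ->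
  exists t, x <= t < x + Z.of_nat n /\ P t /\ Q (t + 1).
Proof.
  revert x; induction n as [|n IH]; intros x Hx Hq D H.
  - destruct (D x); trivial. now replace x with (x + Z.of_nat 0) by lia.
  - destruct (H (x + 1)) as [H1|H1]; [lia| |].
    + destruct (IH (x + 1)) as (t & ? & ?); trivial.
      * now replace (x + 1 + Z.of_nat n) with (x + Z.of_nat (S n)) by lia.
      * intros t Ht. apply H. lia.
      * exists t. split; trivial. lia.
    + exists x. split; [lia|auto].
Qed.

Lemma row_switch_le (P Q : Z -> Prop) x z :
  x <= z -> P x -> Q z -> (forall t, P t -> Q t -> False) ->
  (forall t, x <= t <= z -> P t \/ Q t) ->
  exists t, x <= t < z /\ P t /\ Q (t + 1).
Proof.
  intros Hxz HP HQ D H.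
  replace z with (x + Z.of_nat (Z.to_nat (z - x))) in * by lia.
  now apply row_switch.
Qed.

Lemma bs_row x y : bs ((x, y), Row) ((x + 1, y), Row) = 3%nat /\
                   bs ((x + 1, y), Row) ((x, y), Row) = 3%nat.
Proof. split; apply bs_rowlink; repeat split; cbn; lia. Qed.

Lemma comb_row_cross c a b p p' :
  comb c -> light_cut c a b -> In (p, Row) a -> In (p', Row) b ->
  exists u v, In u a /\ In v b /\ snd u = Row /\ snd v = Row /\ bs u v = 3%nat.
Proof.
  intros (y0 & _ & H2 & H3 & _) L Hp Hp'.
  assert (Ca : forall p, In (p, Row) a -> In (p, Row) c)
    by (intros; apply (light_cut_in _ _ _ _ L); auto).
  assert (Cb : forall p, In (p, Row) b -> In (p, Row) c)
    by (intros; apply (light_cut_in _ _ _ _ L); auto).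
  destruct p as [x y], p' as [x' y'].
  assert (y = y0) by eauto. assert (y' = y0) by eauto. subst y y'.
  assert (D : forall t, In ((t, y0), Row) a -> In ((t, y0), Row) b -> False)
    by (intros t; now apply light_cut_disjoint with c).
  destruct (Z_le_gt_dec x x').
  - destruct (row_switch_le (fun t => In ((t, y0), Row) a)
      (fun t => In ((t, y0), Row) b) x x') as (t & _ & Ht & Ht'); trivial.
    + intros t Ht. apply (light_cut_in _ _ _ _ L). apply (H3 x t x'); auto.
    + exists ((t, y0), Row), ((t + 1, y0), Row). repeat split; trivial. apply bs_row.
  - destruct (row_switch_le (fun t => In ((t, y0), Row) b)
      (fun t => In ((t, y0), Row) a) x' x) as (t & _ & Ht & Ht'); trivial; try lia.
    + intros t; eauto.
    + intros t Ht. apply or_comm, (light_cut_in _ _ _ _ L). apply (H3 x' t x); auto.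
    + exists ((t + 1, y0), Row), ((t, y0), Row). repeat split; trivial. apply bs_row.
Qed.

Lemma bs_above x : contact (snd x) = true ->
  bs x (above x) = 1%nat /\ bs (above x) x = 1%nat.
Proof. intros H. rewrite (bs_sym (above x)). split; apply bs_hang; now split. Qed.

Lemma full_contacts l f e :
  full l f e -> contact (snd f) = true /\ contact (snd e) = true.
Proof. intros (_ & _ & _ & -> & [-> | ->]); now split. Qed.

(* The snake and the part of the row between its two ends form a cycle of the
   bond graph, so a cut of strength at most 3 cannot cross the snake. *)
Lemma hung_not_cut_from c a b l f e w :
  comb c -> light_cut c a b -> full l f e -> incl l c ->
  In (above f) c -> In (above e) c -> In f a -> In w l -> In w b -> False.
Proof.
  intros Hc L F Hi Af Ae Hf Hw Hwb.
  destruct (full_contacts l f e F) as [Cf Ce].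
  assert (Col : forall z, In z l -> In z a \/ In z b)
    by (intros z Hz; apply (light_cut_in _ _ _ _ L); auto).
  assert (Hch : chain l) by apply F.
  assert (NZ := fun z => chain_not_Row l z Hch).
  assert (He := full_last l f e F).
  assert (Fe := Col e He). destruct Fe as [Fe|Fe].
  (* Both ends lie in [a]: the snake is crossed once before and once after [w], which costs 6. *)
  - assert (Hs : exists l1 l2, l = f :: l1 ++ w :: l2 /\ In e l2).
    { destruct F as (_ & (r & Er) & (r' & Er') & _).
      assert (Hw' : In w r).
      { rewrite Er in Hw. destruct Hw as [->|]; trivial.
        now destruct (light_cut_disjoint c a b w L). }
      apply in_split in Hw' as (l1 & l2 & ->). exists l1, l2. split; trivial.
      destruct l2 as [|y l2 _] using rev_ind.
      - rewrite Er in Er'. rewrite app_comm_cons in Er'.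
        apply app_inj_tail in Er' as [_ ->].
        now destruct (light_cut_disjoint c a b e L).
      - rewrite Er in Er'. rewrite (app_comm_cons l2), app_assoc, app_comm_cons in Er'.
        apply app_inj_tail in Er' as [_ ->]. apply in_app_iff; cbn; auto. }
    destruct Hs as (l1 & l2 & E & Hel2).
    assert (E' : l = (f :: l1 ++ [w]) ++ l2)
      by (rewrite E; cbn; now rewrite <- app_assoc).
    destruct (chain_cross [] f (l1 ++ [w]) w a b) as (u & v & ? & ? & B1 & _ & U & _); trivial.
    + cbn. rewrite E' in Hch. now apply chain_app_inv in Hch.
    + intros z Hz. apply Col. rewrite E'. apply in_app_iff; auto.
    + apply in_app_iff; cbn; auto.
    + destruct (chain_cross (f :: l1) w l2 e b a) as (v' & u' & ? & ? & _ & B2 & _ & V); trivial.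
      * now rewrite E in Hch.
      * intros z Hz. apply or_comm, Col. rewrite E. right. apply in_app_iff; auto.
      * assert (K := light_cut_pairs c a b u v u' v' L). rewrite B1, B2 in K.
        enough (6 <= 3)%nat by lia. apply K; trivial. intros [= <- <-].
        apply chain_NoDup, NoDup_map_inv in Hch. rewrite E' in Hch.
        apply in_split in V as (m1 & m2 & ->).
        rewrite app_assoc in Hch. apply NoDup_remove_2 in Hch.
        apply Hch. rewrite !in_app_iff. auto.
  (* The ends lie on different sides: one link of the snake is crossed, and so is one more bond on
     the way back through the row, namely the contact at [e], a row bond or the contact at [f]. This
     costs at least 4. *)
  - assert (Hs : exists r, l = f :: r /\ In e r).
    { destruct F as (_ & (r & Er) & _). exists r. split; trivial.
      rewrite Er in He. destruct He as [->|]; trivial.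
      now destruct (light_cut_disjoint c a b e L). }
    destruct Hs as (r & E & Her).
    destruct (chain_cross [] f r e a b) as (u & v & Ua & Vb & B1 & _ & U & V); trivial.
    + now rewrite E in Hch.
    + intros z Hz. apply Col. now rewrite E.
    + assert (Zu : snd u <> Row) by (apply NZ; now rewrite E).
      assert (Zv : snd v <> Row) by (apply NZ; rewrite E; now right).
      assert (K := fun x y Hx Hy => light_cut_pairs c a b u v x y L Ua Vb Hx Hy).
      rewrite B1 in K.
      apply (light_cut_in _ _ _ _ L) in Af, Ae.
      destruct Af as [Af|Af]; [destruct Ae as [Ae|Ae]|].
      * specialize (K (above e) e Ae Fe). rewrite (proj2 (bs_above e Ce)) in K.
        enough (4 <= 3)%nat by lia. apply K. intros [= -> _]. now apply Zu.
      * destruct (comb_row_cross c a b (fst (above f)) (fst (above e)))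
          as (x & y & Hx & Hy & Ex & _ & B2); trivial.
        specialize (K x y Hx Hy). rewrite B2 in K.
        enough (6 <= 3)%nat by lia. apply K. now intros [= -> _].
      * specialize (K f (above f) Hf Af). rewrite (proj1 (bs_above f Cf)) in K.
        enough (4 <= 3)%nat by lia. apply K. intros [= _ ->]. now apply Zv.
Qed.

Lemma hung_not_cut c a b l f e z :
  comb c -> light_cut c a b -> full l f e -> incl l c ->
  In (above f) c -> In (above e) c -> In z l -> In z a -> incl l a.
Proof.
  intros Hc L F Hi Af Ae Hz Hza w Hw.
  assert (Col : forall z, In z l -> In z a \/ In z b)
    by (intros y Hy; apply (light_cut_in _ _ _ _ L); auto).
  destruct (Col w Hw) as [|Hwb]; trivial; exfalso.
  destruct (Col f (full_first l f e F)) as [Hf|Hf].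
  - now apply (hung_not_cut_from c a b l f e w).
  - apply (hung_not_cut_from c b a l f e z); trivial. now apply light_cut_sym.
Qed.

Definition linked (c : list cell) : Prop :=
  forall x y, In x c -> In y c ->
    clos_refl_trans _ (fun u v => In u c /\ In v c /\ (0 < bs u v)%nat) x y.

(** Hung snakes are never cut. If [a] has a row tile, it keeps an interval of the row and both
    contacts of its snakes, so it is a comb. Otherwise, being connected, it is exactly one complete
    snake. *)
Lemma good_break_comb c a b :
  comb c -> light_cut c a b -> a <> [] -> linked a -> snake a \/ comb a.
Proof.
  intros Hc L Ha Hl.
  assert (Ca : incl a c) by (intros z Hz; apply (light_cut_in _ _ _ _ L); auto).
  assert (Hc' := Hc).
  destruct Hc' as (y0 & _ & H2 & H3 & H4).
  destruct (Exists_dec (fun z : cell => snd z = Row) a) as [E|E].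
  { intros [p q]; destruct q; (now left) || (now right). }
  - right. apply Exists_exists in E as ([[x0 y] q] & Hx0 & E). cbn in E; subst q.
    assert (y = y0) by eauto. subst y.
    exists y0. repeat split.
    + eauto.
    + intros x y Hx. eauto.
    + intros x1 x2 x3 Hx A1 A3.
      assert (A2 : In ((x2, y0), Row) c) by (apply (H3 x1 x2 x3); auto).
      apply (light_cut_in _ _ _ _ L) in A2 as [|A2]; trivial; exfalso.
      assert (D : forall t, In ((t, y0), Row) a -> In ((t, y0), Row) b -> False)
        by (intros t; now apply light_cut_disjoint with c).
      assert (Col : forall t, x1 <= t <= x3 -> In ((t, y0), Row) a \/ In ((t, y0), Row) b).
      { intros t Ht. apply (light_cut_in _ _ _ _ L). apply (H3 x1 t x3); auto. }
      destruct (row_switch_le (fun t => In ((t, y0), Row) a)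
        (fun t => In ((t, y0), Row) b) x1 x2) as (t & T1 & T2 & T3); trivial; try lia.
      { intros; apply Col; lia. }
      destruct (row_switch_le (fun t => In ((t, y0), Row) b)
        (fun t => In ((t, y0), Row) a) x2 x3) as (s & S1 & S2 & S3); trivial; try lia.
      { intros; eauto. }
      { intros; apply or_comm, Col; lia. }
      (* A gap in the row of [a] would cut two row bonds, of total strength 6. *)
      assert (K := light_cut_pairs c a b _ _ _ _ L T2 T3 S3 S2).
      rewrite (proj1 (bs_row t y0)), (proj2 (bs_row s y0)) in K.
      enough (6 <= 3)%nat by lia. apply K. intros [=]; lia.
    + intros z Hz Hn. destruct (H4 z) as (l & f & e & F & Hzl & Hi & Af & Ae); auto.
      assert (Hla : incl l a) by now apply (hung_not_cut c a b l f e z).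
      destruct (full_contacts l f e F) as [Cf Ce].
      (* Were the row tile above [g] in [b], both this contact and a row bond would be cut, of total
         strength 4. *)
      assert (G : forall g, In g l -> contact (snd g) = true -> In (above g) c ->
                  In (above g) a).
      { intros g Hg Cg Ag. apply (light_cut_in _ _ _ _ L) in Ag as [|Ag]; trivial; exfalso.
        destruct (comb_row_cross c a b (x0, y0) (fst (above g)))
          as (u & v & Hu & Hv & Eu & _ & B); trivial.
        assert (K := light_cut_pairs c a b u v g (above g) L Hu Hv (Hla g Hg) Ag).
        rewrite B, (proj1 (bs_above g Cg)) in K.
        enough (4 <= 3)%nat by lia. apply K. intros [= -> _].
        rewrite Eu in Cg. discriminate. }
      exists l, f, e. split; [trivial|]. repeat split; trivial.
      * apply G; trivial. now apply full_first in F.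
      * apply G; trivial. now apply full_last in F.
  - left.
    assert (NZ : forall z, In z a -> snd z <> Row).
    { intros z Hz Ez. apply E, Exists_exists. eauto. }
    destruct a as [|z a']; [easy|]. set (a := z :: a') in *.
    assert (Hz : In z a) by (left; trivial).
    destruct (H4 z) as (l & f & e & F & Hzl & Hi & Af & Ae); auto.
    assert (Hla : incl l a) by now apply (hung_not_cut c a b l f e z).
    (* Walk from [z] along bonds inside [a]: without row tiles each bond is a link, and a complete
       snake is closed under links. *)
    assert (Hal : incl a l).
    { intros w Hw. specialize (Hl z w Hz Hw).
      apply clos_rt_rtn1 in Hl. clear Hw.
      induction Hl as [|u w (Hu & Hw & B) _ IH]; trivial.
      assert (K : In (fst w) (map fst l)).
      { apply (full_closed l f e u w); trivial.
        specialize (NZ u Hu) as Zu; specialize (NZ w Hw) as Zw.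
        destruct (bs_spec u w) as [?|[[_ [H|[H|H]]]|[_ [H|H]]]]; auto; try lia; exfalso.
        - now apply Zu, H.
        - destruct H as [_ ->]. now apply Zw.
        - destruct H as [_ ->]. now apply Zu. }
      apply in_map_fst in K as (w' & Hw' & Ew).
      replace w with w'; trivial.
      apply (pos_inj c); auto. apply L. }
    exists l. split; [|split; [apply F|]].
    + intros ->. now apply (Hal z).
    + apply NoDup_Permutation.
      * apply light_cut_NoDup in L. now apply NoDup_app_remove_r in L.
      * assert (Hch : chain l) by apply F. exact (NoDup_map_inv fst l (chain_NoDup l Hch)).
      * intros w; split; auto.
Qed.

Lemma good_break c a b :
  good c -> Permutation c (a ++ b) -> a <> [] -> b <> [] -> (cut a b <= 3)%nat ->
  linked a -> good a.
Proof.
  intros [N G] P Ha Hb Hcut Hl.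
  assert (L : light_cut c a b) by now repeat split.
  split.
  { apply (Permutation_map fst), (fun H => Permutation_NoDup H N) in P.
    rewrite map_app in P. now apply NoDup_app_remove_r in P. }
  destruct G as [(l & Hn & Hch & Q)|G]; [left|now apply (good_break_comb c a b)].
  destruct (snake_break l a b) as (l1 & l2 & -> & K); trivial.
  - intros z. rewrite <- (light_cut_in _ _ _ _ L).
    split; apply Permutation_in; [symmetry|]; trivial.
  - intros z H1 H2. now apply (light_cut_disjoint c a b z).
  - apply light_cut_NoDup in L. now apply NoDup_app_remove_r in L.
  - apply light_cut_NoDup in L. now apply NoDup_app_remove_l in L.
  - apply chain_app_inv in Hch as [C1 C2].
    destruct K as [[K _]|[K _]]; [exists l1|exists l2]; repeat split; trivial;
      try apply C1; try apply C2; intros ->; apply Ha;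
      apply Permutation_sym, Permutation_nil in K; trivial.
Qed.

(** * Producible and terminal assemblies *)

(** Threshold 2 is met by two contacts, 3 by one strong bond, 4 by no single bond. The middle range
    ends at half the area of the rectangle. *)
Definition temp (k m : nat) : nat :=
  (if m <? k then 2 else if 2 * m <=? 3 * k then 3 else 4)%nat.

Lemma temp_bounds k m : (2 <= temp k m <= 4)%nat.
Proof. unfold temp. destruct (m <? k)%nat, (2 * m <=? 3 * k)%nat; lia. Qed.

Lemma temp_nondecreasing k : nondecreasing (temp k).
Proof.
  intros m n H. unfold temp.
  destruct (Nat.ltb_spec m k), (Nat.ltb_spec n k); try lia;
    destruct (Nat.leb_spec (2 * m) (3 * k)), (Nat.leb_spec (2 * n) (3 * k)); lia.
Qed.

Lemma lookup_In a p t : wf a -> lookup a p = Some t <-> In (p, t) a.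
Proof.
  unfold wf. induction a as [|[q u] a IH]; cbn; [easy|].
  intros H; inversion H; subst.
  unfold pos_eqb. destruct p as [x y], q as [x' y']; cbn.
  destruct (Z.eqb_spec x' x); [destruct (Z.eqb_spec y' y)|]; cbn; subst.
  - split; [intros [= ->]; auto|]. intros [[= ->]|K]; trivial.
    destruct H2. now apply (in_map fst) in K.
  - rewrite IH by trivial. split; auto. intros [[=]|]; congruence.
  - rewrite IH by trivial. split; auto. intros [[=]|]; congruence.
Qed.

Lemma splits_Permutation g a b : wf g -> splits g a b -> Permutation g (a ++ b).
Proof.
  intros Hg [Hab H]. apply NoDup_Permutation.
  - exact (NoDup_map_inv fst g Hg).
  - exact (NoDup_map_inv fst (a ++ b) Hab).
  - intros [p t]. now rewrite <- !lookup_In, H.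
Qed.

Lemma map_fst_emb c : map fst (map emb c) = map fst c.
Proof. rewrite map_map. reflexivity. Qed.

Lemma splits_emb (c : list cell) a b : NoDup (map fst c) -> splits (map emb c) a b ->
  exists ca cb, a = map emb ca /\ b = map emb cb /\ Permutation c (ca ++ cb).
Proof.
  intros Hc H. apply splits_Permutation in H; [|unfold wf; now rewrite map_fst_emb].
  apply Permutation_sym, Permutation_map_inv in H as (d & E & P).
  symmetry in E. apply map_eq_app in E as (ca & cb & -> & <- & <-).
  exists ca, cb. auto.
Qed.

Lemma tile_inj q r : tile q = tile r -> q = r.
Proof. destruct q, r; cbn; congruence. Qed.

Lemma emb_inj x y : emb x = emb y -> x = y.
Proof.
  destruct x, y; unfold emb; cbn. intros [= -> E]. apply tile_inj in E. congruence.
Qed.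

Lemma connected_linked c : connected strength (map emb c) -> linked c.
Proof.
  intros H x y Hx Hy. specialize (H _ _ (in_map emb _ _ Hx) (in_map emb _ _ Hy)).
  apply clos_rt_rt1n in H.
  remember (emb x) as ex eqn:Ex. remember (emb y) as ey eqn:Ey.
  revert x Hx Ex. induction H as [u|u v w (Hu & Hv & B) _ IH]; intros x Hx Ex.
  - subst. apply emb_inj in Ex as ->. apply rt_refl.
  - apply in_map_iff in Hv as (z & <- & Hz).
    apply rt_trans with z; [|now apply IH].
    apply rt_step. subst u. auto.
Qed.

(** * Translations *)

Definition move (d : pos) (x : cell) : cell :=
  ((fst (fst x) + fst d, snd (fst x) + snd d), snd x).

Lemma link_move d x y : link x y -> link (move d x) (move d y).
Proof. unfold link, move; cbn. intros (H & -> & ->). repeat split; trivial; lia. Qed.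

Lemma chain_move d l : chain l -> chain (map (move d) l).
Proof.
  intros [H1 H2]; split.
  - clear H2. induction H1 as [|x l Hl IH Hx]; cbn; constructor; trivial.
    destruct Hx; cbn; constructor. now apply link_move.
  - apply Forall_map. revert H2. apply Forall_impl. auto.
Qed.

Lemma full_move d l f e : full l f e -> full (map (move d) l) (move d f) (move d e).
Proof.
  intros (H1 & (r & H2) & (r' & H3) & H4 & H5). split; [now apply chain_move|].
  repeat split; trivial.
  - exists (map (move d) r). now rewrite H2.
  - exists (map (move d) r'). now rewrite H3, map_app.
Qed.

Lemma above_move d x : above (move d x) = move d (above x).
Proof. unfold above, move; cbn. do 2 f_equal; lia. Qed.

Lemma in_move d p q c :
  In (p, q) (map (move d) c) <-> In ((fst p - fst d, snd p - snd d), q) c.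
Proof.
  rewrite in_map_iff. destruct p as [x y]; split.
  - intros ([[a b] r] & [= <- <- <-] & H). cbn.
    now replace (a + fst d - fst d) with a by lia;
      replace (b + snd d - snd d) with b by lia.
  - intros H. eexists; split; [|exact H]. unfold move; cbn. do 2 f_equal; lia.
Qed.

Lemma good_move d c : good c -> good (map (move d) c).
Proof.
  intros [N G]. split.
  { replace (map fst (map (move d) c))
      with (map (fun p : pos => (fst p + fst d, snd p + snd d)) (map fst c))
      by now rewrite !map_map.
    apply FinFun.Injective_map_NoDup; trivial.
    intros [a b] [a' b'] [=]. f_equal; lia. }
  destruct G as [(l & H1 & H2 & H3)|(y0 & (x0 & H1) & H2 & H3 & H4)]; [left|right].
  - exists (map (move d) l). split; [now destruct l|].
    split; [now apply chain_move|now apply Permutation_map].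
  - exists (y0 + snd d). repeat split.
    + exists (x0 + fst d). exact (in_map (move d) c ((x0, y0), Row) H1).
    + intros x y H. apply in_move, H2 in H. cbn in H. lia.
    + intros x1 x2 x3 Hx. rewrite !in_move. cbn [fst snd].
      replace (y0 + snd d - snd d) with y0 by lia. apply H3. lia.
    + intros z Hz Hn. apply in_map_iff in Hz as (w & <- & Hw).
      destruct (H4 w) as (l & f & e & F & A2 & A3 & A4 & A5); trivial.
      exists (map (move d) l), (move d f), (move d e).
      split; [now apply full_move|]. rewrite !above_move.
      repeat split; try now apply in_map. now apply incl_map.
Qed.

Lemma disjoint_apart a b : disjoint (map emb a) (map emb b) <-> apart a b.
Proof.
  unfold disjoint, dom, apart. rewrite !map_fst_emb. split.
  - intros H x y Hx Hy E. apply (H (fst x)); [now apply in_map|].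
    rewrite E. now apply in_map.
  - intros H p Hp Hp'. apply in_map_iff in Hp as (x & <- & Hx), Hp' as (y & E & Hy).
    now apply (H x y).
Qed.

Lemma single_good x : good [x].
Proof.
  split; [repeat constructor; auto|]. destruct x as [[x y] q].
  destruct (Exists_dec (fun z : cell => snd z = Row) [((x, y), q)]) as [E|E].
  { intros [p r]; destruct r; (now left) || (now right). }
  - right. apply Exists_cons in E as [E|E]; [|now apply Exists_nil in E].
    cbn in E; subst q. exists y. repeat split.
    + exists x. now left.
    + intros x' y' [[= -> ->]|[]]. trivial.
    + intros x1 x2 x3 H [[= <-]|[]] [[= <-]|[]]. left. repeat f_equal. lia.
    + intros z [<-|[]] H. now destruct H.
  - left. exists [((x, y), q)]. repeat split; trivial; [easy|..].
    + repeat constructor.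
    + constructor; [|constructor]. intros K. apply E. now left.
Qed.

(** By [temp_bounds], every combination has cut strength at least 2 and every break at most 3, which
    are the thresholds of [good_combine] and [good_break]. *)
Lemma producible_good k a :
  producible strength tiles (temp k) a -> exists c, a = map emb c /\ good c.
Proof.
  induction 1 as [t p Ht|d a _ (c & -> & G)|a b _ (ca & -> & Ga) _ (cb & -> & Gb) [D H]
    |g a b _ (c & -> & G) (S & Ha & Hb & Ca & Cb & H)
    |g a b _ (c & -> & G) (S & Ha & Hb & Ca & Cb & H)].
  - apply in_map_iff in Ht as (q & <- & _). exists [(p, q)].
    split; trivial. apply single_good.
  - exists (map (move d) c). split; [|now apply good_move].
    unfold translate. rewrite !map_map. reflexivity.
  - exists (ca ++ cb). split; [now rewrite map_app|].
    apply good_combine; trivial; [now apply disjoint_apart|].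
    rewrite cutstr_emb in H. assert (K := temp_bounds k).
    specialize (K (Nat.min (size (map emb ca)) (size (map emb cb)))). lia.
  - destruct (splits_emb c a b) as (ca & cb & -> & -> & P); trivial; [apply G|].
    exists ca. split; trivial. rewrite cutstr_emb in H.
    apply (good_break c ca cb); trivial; try (intros ->; easy).
    + assert (K := temp_bounds k (Nat.min (size (map emb ca)) (size (map emb cb)))). lia.
    + now apply connected_linked.
  - destruct (splits_emb c a b) as (ca & cb & -> & -> & P); trivial; [apply G|].
    exists cb. split; trivial. rewrite cutstr_emb, cut_sym in H.
    apply (good_break c cb ca); trivial; try (intros ->; easy).
    + now rewrite Permutation_app_comm.
    + assert (K := temp_bounds k (Nat.min (size (map emb ca)) (size (map emb cb)))). lia.
    + now apply connected_linked.
Qed.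

(** * Growing snakes and rows tile by tile *)

Lemma single_producible k (x : cell) : producible strength tiles (temp k) (map emb [x]).
Proof. apply prod_single, in_map. destruct (snd x); cbn; tauto. Qed.

Lemma size_emb c : size (map emb c) = length c.
Proof. apply length_map. Qed.

(** The smaller part has size 1, which is below [k], so the threshold is 2 and one strong bond
    suffices. *)
Lemma can_combine_single k c x y : (2 <= k)%nat ->
  In x c -> (3 <= bs x y)%nat -> ~ In (fst y) (map fst c) ->
  can_combine strength (temp k) (map emb c) (map emb [y]).
Proof.
  intros Hk Hx B Hy. split.
  - apply disjoint_apart. intros z w Hz [<-|[]] E. apply Hy. rewrite <- E.
    now apply in_map.
  - rewrite cutstr_emb, !size_emb. cbn [length].
    assert (H := cut_one c [y] x y Hx (or_introl eq_refl)).
    replace (Nat.min (length c) 1) with 1%nat by (destruct c; [easy|cbn; lia]).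
    unfold temp. destruct (Nat.ltb_spec 1 k); lia.
Qed.

Lemma chain_producible k l : (2 <= k)%nat -> chain l -> l <> [] ->
  producible strength tiles (temp k) (map emb l).
Proof.
  intros Hk. induction l as [|x l IH] using rev_ind; [easy|]. intros Hl _.
  destruct l as [|y l _] using rev_ind; [apply single_producible|].
  rewrite map_app. apply prod_combine.
  - apply IH; [now apply chain_app_inv in Hl|now destruct l].
  - apply single_producible.
  - apply can_combine_single with y; trivial; [apply in_app_iff; cbn; auto| |].
    + rewrite <- app_assoc in Hl. apply chain_adjacent in Hl. now rewrite bs_link.
    + apply chain_NoDup in Hl. rewrite map_app in Hl.
      apply NoDup_remove_2 in Hl. now rewrite app_nil_r in Hl.
Qed.

Definition row_cells (x y : Z) (n : nat) : list cell :=
  map (fun i => ((x + Z.of_nat i, y), Row)) (seq 0 n).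

Lemma in_row_cells x y n z : In z (row_cells x y n) <->
  exists x', x <= x' < x + Z.of_nat n /\ z = ((x', y), Row).
Proof.
  unfold row_cells. rewrite in_map_iff. split.
  - intros (i & <- & Hi). apply in_seq in Hi. exists (x + Z.of_nat i). split; trivial; lia.
  - intros (x' & H & ->). exists (Z.to_nat (x' - x)). split.
    + repeat f_equal. lia.
    + apply in_seq. lia.
Qed.

Lemma row_cells_length x y n : length (row_cells x y n) = n.
Proof. unfold row_cells. now rewrite length_map, length_seq. Qed.

Lemma row_cells_NoDup x y n : NoDup (row_cells x y n).
Proof.
  apply FinFun.Injective_map_NoDup; [|apply seq_NoDup]. intros i j [=]. lia.
Qed.

Lemma row_producible k x y n : (2 <= k)%nat ->
  producible strength tiles (temp k) (map emb (row_cells x y (S n))).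
Proof.
  intros Hk. induction n as [|n IH]; [apply single_producible|].
  unfold row_cells in *. rewrite seq_S, map_app, map_app. apply prod_combine; trivial.
  - apply single_producible.
  - apply can_combine_single with ((x + Z.of_nat n, y), Row); trivial.
    + apply in_map_iff. exists n. split; trivial. apply in_seq. lia.
    + rewrite bs_rowlink; [lia|]. repeat split. left. cbn. lia.
    + intros H. apply in_map_fst in H as (z & Hz & E).
      apply in_map_iff in Hz as (i & <- & Hi). apply in_seq in Hi.
      cbn in E. injection E. lia.
Qed.

(** * Dimensions and existence of complete snakes *)

Lemma row_bounds q : 0 <= row q <= 2.
Proof. destruct q; cbn; lia. Qed.

Lemma chain_idx l x : chain (l ++ [x]) -> forall f r, l ++ [x] = f :: r ->
  idx x = idx f + Z.of_nat (length r).
Proof.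
  induction l as [|y l IH]; intros Hl f r E; cbn in E; injection E as <- <-.
  - cbn. lia.
  - destruct (l ++ [x]) as [|g r] eqn:E; [now destruct l|].
    cbn in Hl. rewrite E in Hl. assert (K := chain_adjacent [] y g r Hl). apply link_idx in K.
    cbn [length]. rewrite (IH (proj2 (chain_app_inv [y] _ Hl)) g r eq_refl). lia.
Qed.

(** [idx] rises by one per link and by three per column, so its values at the two ends give the
    length. Comparing a cell with both ends by [prec] confines it to the bounding box. *)
Lemma full_geometry l f e : full l f e ->
  Z.of_nat (length l) = 3 * (fst (fst e) - fst (fst f) + 1) /\
  snd (fst e) = snd (fst f) /\
  forall z, In z l -> fst (fst f) <= fst (fst z) <= fst (fst e) /\
                      snd (fst f) - 2 <= snd (fst z) <= snd (fst f).
Proof.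
  intros F. assert (Hne := full_first_neq_last l f e F).
  assert (Hfin := full_first l f e F).
  destruct F as (Hl & (r & E) & (r' & E') & Hf & He).
  assert (Pf : forall z, In z l -> z = f \/ prec f z).
  { intros z Hz. rewrite E in Hz. destruct Hz as [->|Hz]; auto. right.
    apply (chain_app_prec [f] r); trivial; [now rewrite E in Hl|now left]. }
  assert (Pe : forall z, In z l -> z = e \/ prec z e).
  { intros z Hz. rewrite E' in Hz. apply in_app_iff in Hz as [Hz|[->|[]]]; auto. right.
    apply (chain_app_prec r' [e]); trivial; [now rewrite E' in Hl|now left]. }
  assert (I : idx e = idx f + Z.of_nat (length r)).
  { apply (chain_idx r' e); [now rewrite E' in Hl|congruence]. }
  assert (Pfe : prec f e) by (destruct (Pe f Hfin); congruence).
  assert (Ef : idx f = 3 * fst (fst f)).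
  { unfold idx, bcol. rewrite Hf. cbst. lia. }
  (* [EvenEnd] has offset 2; [O5] has offset 5, counted from the column to its left. Both give the
     same value. *)
  assert (Ee : idx e = 3 * fst (fst e) + 2).
  { unfold idx, bcol. destruct He as [-> | ->]; cbst; lia. }
  assert (Re : snd (fst e) = snd (fst f)).
  { destruct Pfe as (B & _). unfold bottom in B. rewrite Hf in B.
    destruct He as [He|He]; rewrite He in B; cbst; lia. }
  repeat split; trivial.
  - rewrite E. cbn [length]. lia.
  - destruct (Pf z H) as [->|(_ & B & _ & C)]; [lia|].
    unfold idx, bcol in *. rewrite Hf in *.
    destruct (snd z); cbst; lia.
  - destruct (Pe z H) as [->|(_ & B & _ & C)]; [lia|].
    unfold idx, bcol in *.
    destruct He as [He|He]; rewrite He in *; destruct (snd z); cbst; lia.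
  - destruct (Pf z H) as [->|(B & _)]; [lia|].
    unfold bottom in B. rewrite Hf in B. assert (K := row_bounds (snd z)). cbst. lia.
  - destruct (Pf z H) as [->|(B & _)]; [lia|].
    unfold bottom in B. rewrite Hf in B. assert (K := row_bounds (snd z)). cbst. lia.
Qed.

Ltac chain_cells :=
  repeat split; repeat constructor; cbn; try discriminate; try lia.

(** The prefix stops at the foot of a downward column, at the state [M2] from which both the even
    and the odd ending can follow. *)
Lemma prefix_exists x y (j : nat) : exists r,
  chain ((((x, y), Start) :: r) ++ [((x + 2 * Z.of_nat j, y - 2), M2)]).
Proof.
  induction j as [|j (r & IH)].
  - exists [((x, y - 1), M1)]. cbn [app]. chain_cells.
  - set (c := x + 2 * Z.of_nat j) in *.
    exists ((r ++ [((c, y - 2), M2)]) ++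
      [((c + 1, y - 2), M3); ((c + 1, y - 1), M4); ((c + 1, y), M5);
       ((c + 2, y), M0); ((c + 2, y - 1), M1)]).
    replace (x + 2 * Z.of_nat (S j)) with (c + 2) by lia.
    rewrite app_comm_cons, <- app_assoc. cbn [app].
    destruct IH as [I1 I2]. split.
    + apply (Sorted_join link (((x, y), Start) :: r)); trivial; chain_cells.
    + apply (proj2 (Forall_app _ ((((x, y), Start) :: r) ++ [_]) _)); split; trivial.
      repeat constructor; cbn; discriminate.
Qed.

Lemma full_exists n : (2 <= n)%nat -> exists l f e,
  full l f e /\ fst (fst e) - fst (fst f) + 1 = Z.of_nat n.
Proof.
  intros Hn. destruct (Nat.Even_or_Odd n) as [(m & ->)|(m & ->)].
  (* The prefix fills [2 * m - 1] columns; the even ending adds one column, the odd ending below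
     adds two. *)
  - destruct (prefix_exists 0 0 (m - 1)) as (r & I1 & I2).
    set (c := 0 + 2 * Z.of_nat (m - 1)) in *.
    exists ((((((0, 0), Start) :: r) ++ [((c, 0 - 2), M2)]) ++
      [((c + 1, 0 - 2), M3); ((c + 1, 0 - 1), M4)]) ++ [((c + 1, 0), EvenEnd)]).
    do 2 eexists. split; [split; [|split; [|split; [|split]]]|].
    + rewrite <- app_assoc. split.
      * apply Sorted_join; trivial; chain_cells.
      * apply Forall_app; split; trivial.
        repeat constructor; cbn; discriminate.
    + eexists. reflexivity.
    + eexists. reflexivity.
    + reflexivity.
    + now left.
    + cbn [fst]. lia.
  - destruct (prefix_exists 0 0 (m - 1)) as (r & I1 & I2).
    set (c := 0 + 2 * Z.of_nat (m - 1)) in *.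
    exists ((((((0, 0), Start) :: r) ++ [((c, 0 - 2), M2)]) ++
      [((c + 1, 0 - 2), O0); ((c + 2, 0 - 2), O1); ((c + 2, 0 - 1), O2);
       ((c + 1, 0 - 1), O3); ((c + 1, 0), O4)]) ++ [((c + 2, 0), O5)]).
    do 2 eexists. split; [split; [|split; [|split; [|split]]]|].
    + rewrite <- app_assoc. split.
      * apply Sorted_join; trivial; chain_cells.
      * apply Forall_app; split; trivial.
        repeat constructor; cbn; discriminate.
    + eexists. reflexivity.
    + eexists. reflexivity.
    + reflexivity.
    + now right.
    + cbn [fst]. lia.
Qed.

(** * Assemblies that can still grow or break *)

Lemma pred_exists x : snd x <> Row -> snd x <> Start -> exists y, link y x.
Proof.
  intros H1 H2.
  assert (K : exists q, succ q (snd x) = true).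
  { destruct (snd x); try easy;
      [exists M5|exists M0|exists M1|exists M2|exists M3|exists M4|exists M4
      |exists M2|exists O0|exists O1|exists O2|exists O3|exists O4]; trivial. }
  destruct K as (q & K).
  exists ((fst (fst x) - fst (step q), snd (fst x) - snd (step q)), q).
  repeat split; cbn [fst snd]; trivial; lia.
Qed.

Lemma succ_exists x : snd x <> Row -> ~ closed_end (snd x) -> exists y, link x y.
Proof.
  intros H1 H2.
  assert (K : exists q, succ (snd x) q = true).
  { unfold closed_end in H2. destruct (snd x); try easy; try (now destruct H2; auto);
      [exists M1|exists M2|exists M3|exists M4|exists M5|exists M0|exists M1
      |exists O1|exists O2|exists O3|exists O4|exists O5]; trivial. }
  destruct K as (q & K).
  exists ((fst (fst x) + fst (step (snd x)), snd (fst x) + snd (step (snd x))), q).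
  repeat split; cbn [fst snd]; trivial.
Qed.

Lemma list_min (l : list Z) : l <> [] -> exists m, In m l /\ forall x, In x l -> m <= x.
Proof.
  induction l as [|x l IH]; [easy|]. intros _.
  destruct l as [|y l]; [exists x; split; [now left|intros ? [->|[]]; lia]|].
  destruct IH as (m & Hm & H); [easy|].
  destruct (Z_le_gt_dec x m).
  - exists x. split; [now left|]. intros z [->|Hz]; [lia|]. apply H in Hz. lia.
  - exists m. split; [now right|]. intros z [->|Hz]; [lia|]. now apply H.
Qed.

(** The position left of the leftmost row tile is free, because hung snakes lie strictly below the
    row; so one more row tile attaches. *)
Lemma comb_combines k c : (2 <= k)%nat -> comb c ->
  exists y, can_combine strength (temp k) (map emb c) (map emb [y]).
Proof.
  intros Hk (y0 & (x0 & H1) & H2 & H3 & H4).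
  set (zs := filter (fun z : cell => match snd z with Row => true | _ => false end) c).
  assert (Hzs : forall x, In x (map (fun z => fst (fst z)) zs) <-> In ((x, y0), Row) c).
  { intros x. rewrite in_map_iff. unfold zs. split.
    - intros ([[a b] q] & <- & H). apply filter_In in H as [H H'].
      destruct q; try discriminate H'. assert (b = y0) by eauto. now subst b.
    - intros H. eexists; split; [|apply filter_In; split; [exact H|]]; trivial. }
  destruct (list_min (map (fun z => fst (fst z)) zs)) as (m & Hm & Hmin).
  { intros E. apply Hzs in H1. now rewrite E in H1. }
  apply Hzs in Hm. exists ((m - 1, y0), Row).
  apply can_combine_single with ((m, y0), Row); trivial.
  - rewrite bs_rowlink; [lia|]. repeat split. now right.
  - intros H. apply in_map_fst in H as ([p q] & Hz & E). cbn in E; subst p.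
    destruct (cell_eq_dec (m - 1, y0, q) (m - 1, y0, Row)) as [E|N].
    + injection E as ->. apply Hzs, Hmin in Hz. lia.
    + destruct (H4 _ Hz) as (l & f & e & F & Hl & _ & Af & _).
      { intros E. cbn in E. congruence. }
      apply full_geometry in F as (_ & _ & G). apply G in Hl. cbn in Hl.
      apply H2 in Af. lia.
Qed.

(** A row of the same width covers both contacts and has fewer than [k] tiles, so the threshold is
    2. *)
Lemma full_combines k (l : list cell) f e (c : list cell) : Permutation c l -> full l f e ->
  fst (fst e) - fst (fst f) + 1 < Z.of_nat k ->
  can_combine strength (temp k) (map emb c)
    (map emb (row_cells (fst (fst f)) (snd (fst f) + 1)
                (Z.to_nat (fst (fst e) - fst (fst f) + 1)))).
Proof.
  intros P F Hk.
  assert (G := full_geometry l f e F). destruct G as (_ & Re & G).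
  assert (Hfl := full_first l f e F). assert (Hel := full_last l f e F).
  assert (B := G f Hfl). assert (B' := G e Hel).
  destruct (full_contacts l f e F) as [Cf Ce].
  split.
  - apply disjoint_apart. intros x y Hx Hy E.
    apply in_row_cells in Hy as (x' & _ & ->). cbn in E.
    apply (Permutation_in _ P), G in Hx. rewrite E in Hx. cbn in Hx. lia.
  - rewrite cutstr_emb, !size_emb, row_cells_length.
    apply Nat.le_trans with 2%nat.
    { unfold temp. destruct (Nat.ltb_spec
        (Nat.min (length c) (Z.to_nat (fst (fst e) - fst (fst f) + 1))) k); lia. }
    replace 2%nat with (bs f (above f) + bs e (above e))%nat
      by now rewrite (proj1 (bs_above f Cf)), (proj1 (bs_above e Ce)).
    assert (P' := Permutation_in (l := l) (l' := c)).
    apply cut_two; try (apply P'; [now symmetry|trivial]).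
    + apply in_row_cells. eexists; split; [|reflexivity]. lia.
    + apply in_row_cells. exists (fst (fst e)). split; [lia|]. unfold above. now rewrite Re.
    + intros [= E _]. now apply (full_first_neq_last l f e).
Qed.

Lemma linked_connected c : linked c -> connected strength (map emb c).
Proof.
  intros H u v Hu Hv. apply in_map_iff in Hu as (x & <- & Hx), Hv as (y & <- & Hy).
  specialize (H x y Hx Hy). apply clos_rt_rt1n in H.
  induction H as [x|x z y (_ & Hz & B) _ IH]; [apply rt_refl|].
  apply rt_trans with (emb z); [|now apply IH].
  apply rt_step. repeat split; trivial; now apply in_map.
Qed.

Lemma chain_linked l : chain l -> linked l.
Proof.
  assert (Sy : forall l x y,
    clos_refl_trans _ (fun u v => In u l /\ In v l /\ (0 < bs u v)%nat) x y ->
    clos_refl_trans _ (fun u v => In u l /\ In v l /\ (0 < bs u v)%nat) y x).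
  { clear. intros l x y H. induction H as [x y (? & ? & ?)|x|x y z _ ? _ ?].
    - apply rt_step. rewrite bs_sym. auto.
    - apply rt_refl.
    - now apply rt_trans with y. }
  assert (Mo : forall l f x y,
    clos_refl_trans _ (fun u v => In u l /\ In v l /\ (0 < bs u v)%nat) x y ->
    clos_refl_trans _ (fun u v => In u (f :: l) /\ In v (f :: l) /\ (0 < bs u v)%nat) x y).
  { clear. intros l f x y H. induction H as [x y (Hx & Hy & B)|x|x y z _ ? _ ?].
    - apply rt_step. split; [now right|]. split; [now right|exact B].
    - apply rt_refl.
    - now apply rt_trans with y. }
  assert (K : forall l f y, chain (f :: l) -> In y (f :: l) ->
    clos_refl_trans _ (fun u v => In u (f :: l) /\ In v (f :: l) /\ (0 < bs u v)%nat) f y).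
  { clear Sy. intros l'; induction l' as [|g l' IH]; intros f y Hl Hy.
    - destruct Hy as [->|[]]. apply rt_refl.
    - destruct Hy as [->|Hy]; [apply rt_refl|].
      apply rt_trans with g.
      + apply rt_step. split; [now left|]. split; [right; now left|].
        rewrite bs_link; [lia|]. now apply (chain_adjacent [] f g l').
      + apply Mo. apply IH; trivial. exact (proj2 (chain_app_inv [f] _ Hl)). }
  destruct l as [|f l]; intros Hl x y Hx Hy; [easy|].
  apply rt_trans with f; auto.
Qed.

(** By [prec], a bond across the cut is a forward link, which raises [idx] by one. As [x] has the
    largest [idx] before the cut and [y] the smallest after it, no other pair qualifies. *)
Lemma chain_cut_app l1 x y l2 :
  chain ((l1 ++ [x]) ++ y :: l2) -> (cut (l1 ++ [x]) (y :: l2) <= 3)%nat.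
Proof.
  intros Hl. assert (Hl' := Hl). rewrite <- app_assoc in Hl'.
  apply chain_adjacent in Hl'.
  assert (N := chain_NoDup _ Hl).
  assert (ND := NoDup_map_inv fst _ N).
  replace 3%nat with (list_sum (map bsp [(x, y)]))
    by (unfold list_sum; cbn [map fold_right]; unfold bsp; cbn [fst snd];
        now rewrite (bs_link x y)).
  apply cut_le; [now apply NoDup_app_remove_r in ND|now apply NoDup_app_remove_l in ND|].
  intros u v Hu Hv B. left.
  assert (Q := chain_app_prec _ _ u v Hl Hu Hv).
  assert (Zu : snd u <> Row) by (apply (chain_not_Row _ u Hl), in_app_iff; auto).
  assert (Zv : snd v <> Row) by (apply (chain_not_Row _ v Hl), in_app_iff; auto).
  assert (L : link u v).
  { destruct (bs_spec u v) as [?|[[_ [H|[H|H]]]|[_ [H|H]]]]; trivial; try easy; exfalso.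
    - apply link_prec in H. destruct Q as (_ & Q & _), H as (_ & H & _). lia.
    - now apply Zu, H.
    - destruct H as [_ ->]. now apply Zv.
    - destruct H as [_ ->]. now apply Zu. }
  apply link_idx in L. apply link_idx in Hl'.
  assert (Qx : u = x \/ prec u x).
  { apply in_app_iff in Hu as [Hu|[->|[]]]; auto. right.
    apply (chain_app_prec l1 [x]); cbn; auto. now apply chain_app_inv in Hl. }
  assert (Qy : v = y \/ prec y v).
  { destruct Hv as [->|Hv]; auto. right.
    apply (chain_app_prec [y] l2); cbn; auto. now apply chain_app_inv in Hl. }
  destruct Qx as [->|(_ & Qx & _)], Qy as [->|(_ & Qy & _)]; trivial; lia.
Qed.

Lemma full_breaks k (l : list cell) f e (c : list cell) :
  NoDup (map fst c) -> Permutation c l -> full l f e ->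
  Z.of_nat k < fst (fst e) - fst (fst f) + 1 ->
  exists a b, breaks_into strength (temp k) (map emb c) a b.
Proof.
  intros Nc P F Hk. destruct (full_geometry l f e F) as (Len & _ & _).
  destruct F as (Hl & _).
  (* The least size with [2 * m > 3 * k]. A wider snake has at least [3 * k + 3] tiles, so the
     remainder exceeds half of [3 * k] too, and the threshold is 4. *)
  set (m := ((3 * k) / 2 + 1)%nat).
  assert (Hm : (3 * k < 2 * m <= 3 * k + 2)%nat).
  { unfold m. assert (K := Nat.div_mod_eq (3 * k) 2).
    assert (K' := Nat.mod_upper_bound (3 * k) 2 (Nat.neq_succ_0 1)). lia. }
  assert (Hlen : (3 * k + 3 <= length l)%nat) by lia.
  assert (L1 : length (firstn m l) = m) by (apply firstn_length_le; lia).
  assert (L2 : length (skipn m l) = (length l - m)%nat) by apply length_skipn.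
  assert (E := firstn_skipn m l).
  set (l1 := firstn m l) in *. set (l2 := skipn m l) in *.
  rewrite <- E in Hl, P.
  exists (map emb l1), (map emb l2).
  assert (N : NoDup (map fst (l1 ++ l2))) by now apply chain_NoDup.
  repeat split.
  - unfold wf. now rewrite <- map_app, map_fst_emb.
  - intros p. rewrite <- map_app.
    assert (W : wf (map emb c)) by (unfold wf; now rewrite map_fst_emb).
    assert (W' : wf (map emb (l1 ++ l2))) by (unfold wf; now rewrite map_fst_emb).
    assert (K : forall t, In (p, t) (map emb c) <-> In (p, t) (map emb (l1 ++ l2))).
    { intros t. split; apply Permutation_in, Permutation_map; [|symmetry]; trivial. }
    destruct (lookup (map emb c) p) as [t|] eqn:E1.
    + symmetry. apply lookup_In; trivial. now apply K, lookup_In.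
    + destruct (lookup (map emb (l1 ++ l2)) p) as [t|] eqn:E2; trivial.
      apply lookup_In, K, lookup_In in E2; trivial. congruence.
  - intros H. apply map_eq_nil in H. rewrite H in L1. cbn [length] in L1. lia.
  - intros H. apply map_eq_nil in H. rewrite H in L2. cbn [length] in L2. lia.
  - apply linked_connected, chain_linked. now apply chain_app_inv in Hl.
  - apply linked_connected, chain_linked. now apply chain_app_inv in Hl.
  - rewrite cutstr_emb, !size_emb, L1, L2.
    replace (temp k (Nat.min m (length l - m))) with 4%nat.
    2:{ unfold temp. destruct (Nat.ltb_spec (Nat.min m (length l - m)) k); [lia|].
        destruct (Nat.leb_spec (2 * Nat.min m (length l - m)) (3 * k)); lia. }
    apply Nat.lt_succ_r. clearbody l1 l2.
    destruct l1 as [|x l1 _] using rev_ind; [cbn [length] in L1; lia|].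
    destruct l2 as [|y l2]; [cbn [length] in L2; lia|]. now apply chain_cut_app.
Qed.

(** * Terminal assemblies are the complete snakes of width k *)

Lemma terminal_full k a : (2 <= k)%nat -> terminal strength tiles (temp k) a ->
  exists c l f e, a = map emb c /\ NoDup (map fst c) /\ Permutation c l /\
    full l f e /\ fst (fst e) - fst (fst f) + 1 = Z.of_nat k.
Proof.
  intros Hk (Hp & Hc & Hb).
  destruct (producible_good k a Hp) as (c & -> & N & [(l & Hn & Hl & P)|Hcomb]).
  2:{ destruct (comb_combines k c Hk Hcomb) as (y & H). exfalso.
      revert H. apply Hc, single_producible. }
  assert (Pin : forall x, In x l -> In x c)
    by (intros x; apply Permutation_in; now symmetry).
  (* A free position linked to the snake would let a single tile attach. *)
  assert (Ext : forall x y, In x l -> link x y \/ link y x ->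
                  In (fst y) (map fst l)).
  { intros x y Hx Hxy. destruct (in_dec pos_eq_dec (fst y) (map fst l)); trivial.
    exfalso. apply (Hc (map emb [y])); [apply single_producible|].
    apply can_combine_single with x; auto.
    - destruct Hxy as [K|K]; [|rewrite bs_sym]; now rewrite (bs_link _ _ K).
    - intros H. apply n. revert H. apply Permutation_in. now apply Permutation_map. }
  assert (Hf : exists f r, l = f :: r /\ snd f = Start).
  { destruct l as [|f r]; [easy|]. exists f, r. split; trivial.
    assert (Zf : snd f <> Row) by (apply (chain_not_Row (f :: r)); trivial; now left).
    assert (D : {snd f = Start} + {snd f <> Start}) by decide equality.
    destruct D as [|D]; trivial. exfalso.
    destruct (pred_exists f Zf D) as (y & Hy).
    (* A first cell other than [Start] has a predecessor, which extends the chain. Chains do not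
       meet themselves, so its position is free, against [Ext]. The last cell is treated in the same
       way. *)
    assert (C : chain (y :: f :: r)).
    { destruct Hl as [S1 S2]. split; [constructor; trivial; now constructor|].
      constructor; trivial. now apply link_not_Row in Hy. }
    apply chain_NoDup in C. inversion C; subst. apply H1.
    apply (Ext f); [now left|now right]. }
  assert (He : exists e r, l = r ++ [e] /\ closed_end (snd e)).
  { destruct l as [|e r _] using rev_ind; [easy|]. exists e, r. split; trivial.
    assert (Ein : In e (r ++ [e])) by (apply in_app_iff; cbn; auto).
    assert (Ze : snd e <> Row) by now apply (chain_not_Row (r ++ [e])).
    assert (D : closed_end (snd e) \/ ~ closed_end (snd e)).
    { unfold closed_end. destruct (snd e); auto; right; now intros []. }
    destruct D as [|D]; trivial. exfalso.
    destruct (succ_exists e Ze D) as (y & Hy).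
    assert (C : chain ((r ++ [e]) ++ [y])).
    { destruct Hl as [S1 S2]. split.
      - apply Sorted_join; trivial. repeat constructor.
      - apply Forall_app; split; trivial. constructor; [|constructor].
        now apply link_not_Row in Hy. }
    apply chain_NoDup in C. rewrite map_app in C. apply NoDup_remove_2 in C.
    rewrite app_nil_r in C. apply C.
    apply (Ext e); [trivial|now left]. }
  destruct Hf as (f & r & Ef & Sf), He as (e & r' & Ee & Se).
  assert (F : full l f e) by (split; [trivial|repeat split; eauto]).
  exists c, l, f, e. split; [trivial|]. split; [trivial|]. split; [trivial|].
  split; [trivial|].
  assert (G := proj2 (proj2 (full_geometry l f e F)) f (full_first l f e F)).
  destruct (Z.lt_trichotomy (fst (fst e) - fst (fst f) + 1) (Z.of_nat k)) as [H|[H|H]];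
    trivial; exfalso.
  - apply (full_combines k l f e c P F) in H. revert H. apply Hc.
    destruct (Z.to_nat (fst (fst e) - fst (fst f) + 1)) eqn:En; [lia|].
    now apply row_producible.
  - destruct (full_breaks k l f e c N P F H) as (a & b & K). now apply Hb in K.
Qed.

(** A partner can bond by the two contacts at most, so it must reach both; its row then spans [k]
    columns and raises the threshold to 3. Any break cuts strength at least 3, while its smaller
    part has at most half of the [3 * k] tiles. *)
Lemma full_terminal k l f e : (2 <= k)%nat -> full l f e ->
  fst (fst e) - fst (fst f) + 1 = Z.of_nat k ->
  terminal strength tiles (temp k) (map emb l).
Proof.
  intros Hk F W.
  assert (Hch : chain l) by apply F.
  destruct (full_geometry l f e F) as (Len & Re & G).
  assert (Nl := NoDup_map_inv fst l (chain_NoDup l Hch)).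
  destruct (full_contacts l f e F) as [Cf Ce].
  repeat split.
  - apply chain_producible; trivial. intros ->. now apply full_first in F.
  - intros b Hb [D H]. apply producible_good in Hb as (c & -> & Gc).
    apply disjoint_apart in D. rewrite cutstr_emb, !size_emb in H.
    assert (Nc := good_NoDup c Gc).
    assert (K : forall x y, In x l -> In y c -> bs x y <> 0%nat ->
                 y = above x /\ (x = f \/ x = e)).
    { intros x y Hx Hy B.
      assert (Zx := chain_not_Row l x Hch Hx).
      assert (C : forall P, link x y \/ link y x -> P).
      { intros P L. exfalso. apply (full_closed l f e) in L; trivial.
        apply in_map_fst in L as (z & Hz & Ez). now apply (D z y). }
      destruct (bs_spec x y) as [?|[[_ [L|[L|L]]]|[_ [L|L]]]]; try easy;
        try (apply C; tauto).
      - exfalso. now apply Zx, L.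
      - destruct L as [L ->]. split; trivial. now apply (full_contact l f e).
      - exfalso. destruct L as [_ ->]. now apply Zx. }
    assert (U : (cut l c <= 2)%nat).
    { replace 2%nat with (list_sum (map bsp [(f, above f); (e, above e)])).
      2:{ unfold list_sum; cbn [map fold_right]; unfold bsp; cbn [fst snd].
          now rewrite (proj1 (bs_above f Cf)), (proj1 (bs_above e Ce)). }
      apply cut_le; trivial. intros x y Hx Hy B.
      destruct (K x y Hx Hy B) as [-> [-> | ->]]; cbn; auto. }
    assert (T := temp_bounds k (Nat.min (length l) (length c))).
    assert (Af : In (above f) c /\ In (above e) c).
    { destruct (cut_ge2 l c) as [(x & y & Hx & Hy & B)|
        (x & y & x' & y' & Hx & Hy & Hx' & Hy' & B & B' & N)]; trivial; [lia|..].
      - exfalso. destruct (K x y) as [-> [-> | ->]]; trivial; [congruence|..];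
          [rewrite (proj1 (bs_above f Cf)) in B|rewrite (proj1 (bs_above e Ce)) in B];
          discriminate.
      - destruct (K x y) as [-> Dx]; trivial; [congruence|].
        destruct (K x' y') as [-> Dx']; trivial; [congruence|].
        destruct Dx as [-> | ->], Dx' as [-> | ->]; auto; now destruct N. }
    destruct Af as [Af Ae].
    destruct Gc as [_ [Gc|(y0 & _ & H2 & H3 & _)]].
    { now apply (snake_not_Row c (above f) Gc Af). }
    assert (Ey := H2 _ _ Af). assert (Ey' := H2 _ _ Ae).
    unfold above in Af, Ae. rewrite Ey in Af. rewrite Ey' in Ae.
    (* The row of the partner is contiguous, so it contains every position between the two
       contacts. *)
    assert (I : (k <= length c)%nat).
    { rewrite <- (row_cells_length (fst (fst f)) y0 k).
      apply NoDup_incl_length; [apply row_cells_NoDup|].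
      intros z Hz. apply in_row_cells in Hz as (x' & Hx' & ->).
      apply (H3 (fst (fst f)) x' (fst (fst e))); trivial. lia. }
    unfold temp in H. destruct (Nat.ltb_spec (Nat.min (length l) (length c)) k); [lia|].
    destruct (2 * Nat.min (length l) (length c) <=? 3 * k)%nat; lia.
  - intros b c (S & Hb & Hc & _ & _ & H).
    destruct (splits_emb l b c) as (cb & cc & -> & -> & P); trivial.
    { now apply chain_NoDup. }
    rewrite cutstr_emb, !size_emb in H.
    assert (N : NoDup (cb ++ cc)) by now apply (Permutation_NoDup P).
    assert (3 <= cut cb cc)%nat.
    { apply (chain_cut l); trivial.
      - intros z. rewrite <- in_app_iff. split; apply Permutation_in; trivial.
        now symmetry.
      - intros z Hz Hz'. apply in_split in Hz as (m1 & m2 & ->).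
        rewrite <- app_assoc in N. apply NoDup_remove_2 in N. apply N.
        rewrite !in_app_iff; auto.
      - intros ->. now apply Hb.
      - intros ->. now apply Hc. }
    apply Permutation_length in P. rewrite length_app in P.
    unfold temp in H. destruct (Nat.ltb_spec (Nat.min (length cb) (length cc)) k); [lia|].
    destruct (Nat.leb_spec (2 * Nat.min (length cb) (length cc)) (3 * k)); lia.
Qed.

Lemma full_rect k (l : list cell) f e (c : list cell) :
  NoDup (map fst c) -> Permutation c l -> full l f e ->
  fst (fst e) - fst (fst f) + 1 = Z.of_nat k ->
  exists d, forall p, In p (dom (translate d (map emb c))) <-> rect k 3 p.
Proof.
  intros N P F W. destruct (full_geometry l f e F) as (Len & Re & G).
  (* The snake starts at its top left corner, which goes to [(1, 3)]. *)
  exists (1 - fst (fst f), 3 - snd (fst f)).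
  set (d := (1 - fst (fst f), 3 - snd (fst f))).
  assert (E : dom (translate d (map emb c)) =
              map (fun q : pos => (fst q + fst d, snd q + snd d)) (map fst c)).
  { unfold dom, translate. now rewrite !map_map. }
  rewrite E. clear E.
  set (R := list_prod (map Z.of_nat (seq 1 k)) (map Z.of_nat (seq 1 3))).
  assert (HR : forall p, In p R <-> rect k 3 p).
  { intros [x y]. unfold R, rect. rewrite in_prod_iff, !in_map_iff. cbn [fst snd].
    split.
    - intros [(i & <- & Hi) (j & <- & Hj)]. apply in_seq in Hi, Hj. lia.
    - intros [Hx Hy]. split; [exists (Z.to_nat x)|exists (Z.to_nat y)];
        rewrite in_seq; lia. }
  set (L := map (fun q : pos => (fst q + fst d, snd q + snd d)) (map fst c)).
  assert (I : incl L R).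
  { intros p Hp. apply HR. unfold L in Hp. rewrite map_map in Hp.
    apply in_map_iff in Hp as (z & <- & Hz).
    apply (Permutation_in _ P), G in Hz. unfold rect, d; cbn [fst snd]. lia. }
  intros p. rewrite <- HR. split; [apply I|]. revert p.
  (* The snake has [3 * k] distinct cells inside a rectangle of that size, so it fills the
     rectangle. *)
  apply NoDup_length_incl; trivial.
  - apply FinFun.Injective_map_NoDup; trivial.
    intros [a b] [a' b'] [=]. f_equal; lia.
  - assert (LR : @length pos R = (k * 3)%nat).
    { unfold R. etransitivity; [apply length_prod|]. now rewrite !length_map, !length_seq. }
    assert (LL : @length pos L = @length cell l).
    { unfold L. rewrite !length_map. exact (Permutation_length P). }
    rewrite LR, LL. lia.
Qed.

Theorem theorem1 :
  exists (str : glue -> nat) (T : list tiletype),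
    forall k : nat, (7 <= k)%nat ->
      exists tau : nat -> nat,
        nondecreasing tau /\ self_assembles str T tau (rect k 3).
Proof.
  exists strength, tiles. intros k Hk. assert (H2 : (2 <= k)%nat) by lia.
  exists (temp k). split; [apply temp_nondecreasing|]. split.
  - destruct (full_exists k H2) as (l & f & e & F & W).
    exists (map emb l). now apply (full_terminal k l f e).
  - intros a Ha. destruct (terminal_full k a H2 Ha) as (c & l & f & e & -> & N & P & F & W).
    now apply (full_rect k l f e c).
Qed.
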